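(* There exist $2^{\aleph_1}$ pairwise non-diffeomorphic differential structures on $\mathbb L_+^2$ each of which is a product structure, i.e. of the form $(\mathbb L_+,\mathcal D)\times(\mathbb L_+,\mathcal E)$ for differential structures $\mathcal D,\mathcal E$ on $\mathbb L_+$.
   Context: $\omega_1$ denotes the set of countable ordinals. The closed long ray $\mathbb L_{\ge0}$ is $\omega_1\times[0,1)$ with the lexicographic order topology, and the long ray is $\mathbb L_+=\mathbb L_{\ge0}\setminus\{(0,0)\}$. A ''differential structure'' means a $C^r$ differential structure for some $r\ge1$. *)

(* Defs.v *)
From HB Require Import structures.
From mathcomp Require Import all_boot all_order all_algebra.
From mathcomp Require Import all_classical all_reals all_analysis.

Set Implicit Arguments.
Unset Strict Implicit.
Unset Printing Implicit Defensive.

Import Order.TTheory GRing.Theory Num.Theory.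
Import numFieldNormedType.Exports.

Local Open Scope classical_set_scope.
Local Open Scope ring_scope.

Definition is_omega1 (d : Order.disp_t) (W : orderType d) : Prop :=
  [/\ (forall A : set W, A !=set0 -> exists2 x, A x & forall y, A y -> (x <= y)%O),
      ~ countable [set: W]
    & forall x : W, countable [set y : W | (y < x)%O]].

Section LongRay.
Variable R : realType.

Definition unit_itv := {x : R | (0 <= x) && (x < 1)}.
HB.instance Definition _ := [isSub of unit_itv for (@sval R (fun x => (0 <= x) && (x < 1)))].
HB.instance Definition _ := [Choice of unit_itv by <:].
HB.instance Definition _ :=
  [SubChoice_isSubOrder of unit_itv by <: with ring_display].

Variables (d : Order.disp_t) (W : orderType d).

Definition Lge0 := order_topology (W *l unit_itv)%type.

(* the points other than the least one (0,0) *)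
Definition Lplus_carrier := {p : Lge0 | `[< exists q : Lge0, (q < p)%O >]}.

Definition Lplus := initial_topology (@sval Lge0 _ : Lplus_carrier -> Lge0).

End LongRay.

Section Calculus.
Variable R : realType.

Definition evec (n : nat) (i : 'I_n) : 'rV[R]_n := delta_mx 0 i.

Fixpoint Ck_on (n m : nat) (k : nat) (U : set 'rV[R]_n)
    (f : 'rV[R]_n -> 'rV[R]_m) {struct k} : Prop :=
  match k with
  | 0 => {within U, continuous f}
  | k'.+1 => [/\ {within U, continuous f},
                 (forall (i : 'I_n) x, U x -> derivable f x (evec i))
               & forall i : 'I_n, Ck_on k' U ('D_(evec i) f)]
  end.

End Calculus.

(* regularity r in {1, 2, ..., oo} (together with 0, excluded later) *)
Inductive regularity := Cfin of nat | Cinf.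

Definition C_on (R : realType) (r : regularity) (n m : nat)
    (U : set 'rV[R]_n) (f : 'rV[R]_n -> 'rV[R]_m) : Prop :=
  match r with
  | Cfin k => Ck_on k U f
  | Cinf => forall k, Ck_on k U f
  end.

Record chart (R : realType) (X : Type) (n : nat) := Chart {
  cdom : set X;
  cmap : X -> 'rV[R]_n }.

Section Manifolds.
Variable R : realType.

Definition is_chart (X : topologicalType) (n : nat) (c : chart R X n) : Prop :=
  [/\ open (cdom c),
      set_inj (cdom c) (cmap c),
      {within cdom c, continuous (cmap c)}
    & forall O : set X, open O -> O `<=` cdom c -> open (cmap c @` O)].

(* the transition map  cmap d o (cmap c)^-1  is C^r on cmap c (dom c /\ dom d) *)
Definition compatible (r : regularity) (X : Type) (n : nat)
    (c e : chart R X n) : Prop :=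
  exists g : 'rV[R]_n -> 'rV[R]_n,
    C_on r (cmap c @` (cdom c `&` cdom e)) g /\
    forall p, cdom c p -> cdom e p -> g (cmap c p) = cmap e p.

Definition atlas (r : regularity) (X : topologicalType) (n : nat)
    (A : set (chart R X n)) : Prop :=
  [/\ forall c, A c -> is_chart c,
      forall x : X, exists2 c, A c & cdom c x
    & forall c e, A c -> A e -> compatible r c e].

Definition Cr_map (r : regularity) (X Y : topologicalType) (n m : nat)
    (A : set (chart R X n)) (B : set (chart R Y m)) (f : X -> Y) : Prop :=
  continuous f /\
  forall c e, A c -> B e ->
    exists g : 'rV[R]_n -> 'rV[R]_m,
      C_on r (cmap c @` (cdom c `&` f @^-1` cdom e)) g /\
      forall p, cdom c p -> cdom e (f p) -> g (cmap c p) = cmap e (f p).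

Definition diffeomorphic (r : regularity) (X Y : topologicalType) (n m : nat)
    (A : set (chart R X n)) (B : set (chart R Y m)) : Prop :=
  exists (f : X -> Y) (g : Y -> X),
    [/\ cancel f g, cancel g f, Cr_map r A B f & Cr_map r B A g].

Definition prod_chart (X Y : Type) (n m : nat)
    (c : chart R X n) (e : chart R Y m) : chart R (X * Y) (n + m) :=
  @Chart R (X * Y) (n + m) (cdom c `*` cdom e)
    (fun p => row_mx (cmap c p.1) (cmap e p.2)).

Definition prod_atlas (X Y : Type) (n m : nat)
    (A : set (chart R X n)) (B : set (chart R Y m)) : set (chart R (X * Y) (n + m)) :=
  [set h | exists c e, [/\ A c, B e & h = prod_chart c e]].

End Manifolds.

(* Main.v *)
Require Import Defs.
From HB Require Import structures.
From mathcomp Require Import all_boot all_order all_algebra.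
From mathcomp Require Import all_classical all_reals all_analysis.
From mathcomp Require Import ring lra.

(* A function [P] on the countable ordinals that is strictly increasing and continuous at
   limits ("normal") embeds an initial segment of the long ray in R, [x] going to [P x].
   If two such functions have all but finitely many increments in common, the change of
   coordinates is a C^oo diffeomorphism of R, so a family [F a] of normal functions on
   [[0, a]] that is coherent modulo finite gives a smooth structure.  When [F a] is built at
   a limit [a], finitely many changes between consecutive terms of an omega-sequence
   converging to [a] allow one to prescribe how fast [F a] converges at [a]; we choose it
   to encode the set [S] intersected with [a] by a real number.

   A homeomorphism [f] of the square of the long ray satisfies [f ([0, xi[^2) = [0, xi[^2]
   for arbitrarily large [xi], and at a limit [a] of such [xi] it moves the corner [(a, a)]
   to a point with a coordinate equal to [a].  If [f] is C^1 it is Lipschitz near the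
   corner, and comparing the images of the points [(xi, xi)] shows that the rates at [a] of
   the two structures agree up to a constant, hence so do the sets below [a]. *)

Set Implicit Arguments.
Unset Strict Implicit.
Unset Printing Implicit Defensive.

Import Order.TTheory GRing.Theory Num.Theory.
Import numFieldNormedType.Exports.

Local Open Scope classical_set_scope.

(** * Countable ordinals *)

Section Omega1.
Local Open Scope ring_scope.
Context (d : Order.disp_t) (W : orderType d) (hW : is_omega1 W).
Implicit Types x y z a b : W.

Lemma least_element (A : set W) : A !=set0 ->
  exists2 x, A x & forall y, A y -> (x <= y)%O.
Proof.
by have [h _ _] := hW; exact: h.
Qed.

Lemma lt_wf : well_founded (fun x y => (x < y)%O).
Proof.
move=> x; apply: contrapT => nx.
have [y ny miny] : exists2 y, ~ Acc (fun x y => (x < y)%O) y &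
    forall z, ~ Acc (fun x y => (x < y)%O) z -> (y <= z)%O.
  by apply: least_element; exists x.
apply: ny; constructor => z zy; apply: contrapT => /miny.
by rewrite leNgt zy.
Qed.

Lemma countable_le x : countable [set y | (y <= x)%O].
Proof.
have -> : [set y | (y <= x)%O] =
    \bigcup_(b in [set: bool]) (if b then [set x] else [set y | (y < x)%O]).
  apply/seteqP; split => y /=; rewrite le_eqVlt.
    by case/orP => [/eqP ->|?]; [exists true|exists false].
  by move=> [[] _ /= ->]; rewrite ?eqxx ?orbT.
apply: bigcup_countable => [|[] _]; [exact: countableP|exact: countable1|].
by have [_ _] := hW; exact.
Qed.

(** Without a bound, the initial segments closed at the elements of [A] would cover [W], a countable
    union of countable sets. *)
Lemma countable_bounded (A : set W) : countable A ->
  exists b, forall a, A a -> (a < b)%O.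
Proof.
move=> cA; apply: contrapT => nb.
have [_ + _] := hW; apply.
have -> : [set: W] = \bigcup_(a in A) [set y | (y <= a)%O].
  apply/seteqP; split => // b _; apply: contrapT => nAb; apply: nb.
  exists b => a Aa; rewrite ltNge; apply/negP => ba; apply: nAb.
  by exists a.
by apply: bigcup_countable => // a _; exact: countable_le.
Qed.

Lemma exists_gt x : exists y, (x < y)%O.
Proof.
by have [b hb] := countable_bounded (finite_set_countable (finite_set1 x));
  exists b; exact: hb.
Qed.

Lemma exists_succ x :
  exists y, (x < y)%O /\ forall z, (x < z)%O -> (y <= z)%O.
Proof.
by have [y xy miny] := least_element (exists_gt x); exists y.
Qed.

Definition succ x := sval (cid (exists_succ x)).

Lemma lt_succ x : (x < succ x)%O.
Proof. by case: (svalP (cid (exists_succ x))). Qed.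

Lemma succ_le x y : (succ x <= y)%O = (x < y)%O.
Proof.
apply/idP/idP => [|xy]; first by apply: lt_le_trans; exact: lt_succ.
by case: (svalP (cid (exists_succ x))) => _; exact.
Qed.

Lemma lt_succE x y : (x < succ y)%O = (x <= y)%O.
Proof. by rewrite ltNge succ_le leNgt. Qed.

Lemma exists_bot : exists x, forall y, (x <= y)%O.
Proof.
have [x0 _] : exists x : W, True.
  apply: contrapT => nW; have [_ + _] := hW; apply.
  suff -> : [set: W] = set0 by exact: countable0.
  by apply/seteqP; split => // x _; apply: nW; exists x.
have [x _ hx] := least_element (ex_intro _ x0 I).
by exists x => y; exact: hx.
Qed.

Definition bot := sval (cid exists_bot).

Lemma bot_le x : (bot <= x)%O.
Proof. exact: (svalP (cid exists_bot)). Qed.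

Definition limit x := (bot < x)%O /\ forall y, (y < x)%O -> (succ y < x)%O.

Lemma bot_succ_limit x : [\/ x = bot, exists y, x = succ y | limit x].
Proof.
have [->|xb] := eqVneq x bot; first by constructor 1.
have [?|ns] := pselect (exists y, x = succ y); first by constructor 2.
constructor 3; split; first by rewrite lt_neqAle eq_sym xb bot_le.
move=> y yx; rewrite lt_neqAle succ_le yx andbT; apply/eqP => e.
by apply: ns; exists y.
Qed.

Lemma succ_not_limit x : ~ limit (succ x).
Proof. by case=> _ /(_ x (lt_succ x)); rewrite ltxx. Qed.

Lemma lub_seq (u : nat -> W) : (forall n, (u n < u n.+1)%O) ->
  exists s, (forall n, (u n < s)%O) /\ (forall x, (x < s)%O -> exists n, (x < u n)%O).
Proof.
move=> u_lt.
have [s us mins] : exists2 s, (forall n, (u n < s)%O) &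
    forall z, (forall n, (u n < z)%O) -> (s <= z)%O.
  apply: least_element.
  have [|b hb] := @countable_bounded (range u).
    exact: sub_countable (card_image_le _ _) (countableP _).
  by exists b => n; apply: hb; exists n.
exists s; split => // x xs; apply: contrapT => nx.
have /mins : forall n, (u n < x)%O.
  move=> n; apply: (lt_le_trans (u_lt n)); rewrite leNgt; apply/negP => h.
  by apply: nx; exists n.+1.
by rewrite leNgt xs.
Qed.

Lemma lub_limit (u : nat -> W) s : (forall n, (u n < s)%O) ->
  (forall x, (x < s)%O -> exists n, (x < u n)%O) -> limit s.
Proof.
move=> us su; split; first exact: le_lt_trans (bot_le _) (us 0).
by move=> y /su [n yn]; apply: le_lt_trans (us n); rewrite succ_le.
Qed.

(** A cofinal sequence of type omega. Starting at [bot] makes its steps cover the whole segment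
    below [a], so every [x < a] falls between two consecutive terms. *)
Definition ladder a (u : nat -> W) := [/\ u 0 = bot, forall n, (u n < u n.+1)%O,
  forall n, (u n < a)%O & forall x, (x < a)%O -> exists n, (x < u n)%O].

Lemma exists_ladder a : limit a -> exists u, ladder a u.
Proof.
move=> [a0 alim].
have /countable_injP[f finj] : countable [set y | (y < a)%O] by have [_ _] := hW; exact.
(* An enumeration of the ordinals below [a]; the default [bot] lies below [a] as well. *)
pose e n := xget bot [set y | (y < a)%O /\ f y = n].
have ea n : (e n < a)%O.
  by rewrite /e; case: xgetP => [y _ [ya _]//|_].
have ef y : (y < a)%O -> e (f y) = y.
  move=> ya; rewrite /e; case: xgetP => [z _ [za fz]|/(_ y)]; last first.
    by move=> h; exfalso; apply: h.
  by apply: finj; rewrite ?inE.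
(* Each term passes its predecessor and the next ordinal of the enumeration, which gives both
   monotonicity and cofinality. *)
pose u := fix u n := if n is m.+1 then succ (Order.max (u m) (e m)) else bot.
have ua n : (u n < a)%O.
  elim: n => //= n IH; apply: alim; rewrite /Order.max.
  by case: ifP.
exists u; split => //.
- by move=> n /=; apply: le_lt_trans (lt_succ _); rewrite le_max lexx.
- move=> x xa; exists (f x).+1 => /=; rewrite ef//.
  by apply: le_lt_trans (lt_succ _); rewrite le_max lexx orbT.
Qed.

End Omega1.

(** * Smooth functions of one variable *)

Section Smooth.
Local Open Scope ring_scope.
Context {R : realType}.
Implicit Types f g u v : R -> R.

Fixpoint Ck (k : nat) f : Prop :=
  if k is k'.+1 then (forall x, derivable f x 1) /\ Ck k' (derive1 f) else continuous f.

Definition smooth f := forall k, Ck k f.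

Lemma derivable_cont f : (forall x, derivable f x 1) -> continuous f.
Proof.
by move=> df x; apply: differentiable_continuous; apply/derivable1_diffP.
Qed.

Lemma Ck_cont k f : Ck k f -> continuous f.
Proof. by case: k => //= k [/derivable_cont]. Qed.

Lemma CkS k f : Ck k.+1 f -> Ck k f.
Proof.
elim: k f => [|k IH] f; first by move=> [/derivable_cont].
by move=> [df /IH h]; split.
Qed.

Lemma Ck_step k f f' : (forall x : R, is_derive x (1 : R) f (f' x)) -> Ck k f' ->
  Ck k.+1 f.
Proof.
move=> df Cf'; split; first by move=> x; case: (df x).
suff -> : (derive1 f) = f' by [].
by apply/funext => x; rewrite derive1E derive_val.
Qed.

Lemma CkP k f : Ck k.+1 f -> (forall x : R, is_derive x (1 : R) f ((derive1 f) x)) /\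
  Ck k (derive1 f).
Proof.
move=> [df Cf']; split=> [x|]; last exact: Cf'.
by apply: DeriveDef; [exact: df|rewrite derive1E].
Qed.

Lemma Ck_cst k (c : R) : Ck k (fun=> c).
Proof.
elim: k c => [|k IH] c; first exact: cst_continuous.
by apply: (Ck_step (f' := fun=> 0)).
Qed.

Lemma Ck_id k : Ck k (fun x : R => x).
Proof.
case: k => [|k]; first by move=> x; exact: cvg_id.
by apply: (Ck_step (f' := fun=> 1)); exact: Ck_cst.
Qed.

Lemma CkD k f g : Ck k f -> Ck k g -> Ck k (fun x => f x + g x).
Proof.
elim: k f g => [|k IH] f g; first by move=> cf cg x; apply: cvgD; [exact: cf|exact: cg].
move=> /CkP[df cf] /CkP[dg cg].
have d x : is_derive x (1 : R) (fun x => f x + g x) ((derive1 f) x + (derive1 g) x).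
  exact: (is_deriveD (df x) (dg x)).
by apply: (Ck_step d); exact: IH.
Qed.

Lemma CkM k f g : Ck k f -> Ck k g -> Ck k (fun x => f x * g x).
Proof.
elim: k f g => [|k IH] f g; first by move=> cf cg x; apply: cvgM; [exact: cf|exact: cg].
move=> Cf Cg; have [df cf] := CkP Cf; have [dg cg] := CkP Cg.
have d x : is_derive x (1 : R) (fun x => f x * g x)
    (f x * (derive1 g) x + g x * (derive1 f) x).
  exact: (is_deriveM (df x) (dg x)).
apply: (Ck_step d).
by apply: CkD; apply: IH => //; exact: CkS.
Qed.

Lemma Ck_comp k f g : Ck k f -> Ck k g -> Ck k (fun x => f (g x)).
Proof.
elim: k f g => [|k IH] f g.
  by move=> cf cg x; apply: continuous_comp; [exact: cg|exact: cf].
move=> Cf Cg; have [df cf] := CkP Cf; have [dg cg] := CkP Cg.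
have d x : is_derive x (1 : R) (fun x => f (g x)) ((derive1 f) (g x) * (derive1 g) x).
  exact: (is_derive1_comp (df (g x)) (dg x)).
apply: (Ck_step d).
by apply: CkM => //; apply: IH => //; exact: CkS.
Qed.

Lemma CkV k f : (forall x, f x != 0) -> Ck k f -> Ck k (fun x => (f x)^-1).
Proof.
move=> f0; elim: k f f0 => [|k IH] f f0.
  by move=> cf x; apply: cvgV => //; exact: cf.
move=> Cf; have [df cf] := CkP Cf.
have d x : is_derive x (1 : R) (fun x => (f x)^-1)
    ((- 1) * (((f x)^-1 * (f x)^-1) * (derive1 f) x)).
  apply: (is_derive_eq (is_deriveV (f0 x) (df x))).
  by rewrite mulN1r /GRing.scale /= expr2 invfM mulNr.
apply: (Ck_step d).
have CV : Ck k (fun x => (f x)^-1) by apply: IH => //; exact: CkS.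
by apply: CkM; [exact: Ck_cst|apply: CkM => //; exact: CkM].
Qed.

(** Bootstrapping: the derivative of [g] is the inverse of [f'] composed with [g], hence as regular
    as [g] itself, and each round gains one order. *)
Lemma Ck_inverse k f g : cancel f g -> cancel g f ->
  (forall x, (derive1 f) x != 0) -> Ck k.+1 f -> Ck k.+1 g.
Proof.
move=> fK gK f'0 Cf; have [df cf] := CkP Cf.
have dg x : is_derive x (1 : R) g ((derive1 f) (g x))^-1.
  rewrite -{1}(gK x); apply: (is_derive_inverse _ _ (df (g x)) (f'0 (g x))).
  - by near=> y; exact: fK.
  - by near=> y; apply: (Ck_cont Cf).
elim: k Cf cf => [|k IH] Cf cf; apply: (Ck_step dg).
  apply: (@Ck_comp 0 (fun x => ((derive1 f) x)^-1)); first exact: CkV.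
  by apply: derivable_cont => x; case: (dg x).
apply: (@Ck_comp k.+1 (fun x => ((derive1 f) x)^-1)); first exact: CkV.
by apply: IH; [exact: CkS|case: (CkS Cf)].
Unshelve. all: by end_near. Qed.

End Smooth.

(** * Smooth functions that are flat at the origin *)

Section Flat.
Local Open Scope ring_scope.
Context {R : realType}.
Implicit Types (x y c : R) (f g : R -> R).

(** The power of the inverse is carried along so that derivatives are again linear combinations of
    functions of this family. *)
Definition flat (n : nat) x : R :=
  if 0 < x then x^-1 ^+ n * expR (- x^-1) else 0.

Lemma flat_ge0 n x : 0 <= flat n x.
Proof.
by rewrite /flat; case: ifPn => // x0; rewrite mulr_ge0 ?expR_ge0 ?exprn_ge0 ?invr_ge0 ?ltW.
Qed.

Lemma flat_gt0 n x : 0 < x -> 0 < flat n x.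
Proof. by move=> x0; rewrite /flat x0 mulr_gt0 ?expR_gt0 ?exprn_gt0 ?invr_gt0. Qed.

Lemma flat0 n x : x <= 0 -> flat n x = 0.
Proof. by rewrite /flat ltNge => ->. Qed.

(** The exponential of [x^-1] dominates the term of degree [n.+1] of its power series, one degree
    more than needed, which leaves a factor [x]. *)
Lemma flat_le n x : flat n x <= n.+1`!%:R * `|x|.
Proof.
have [x0|x0] := ltP 0 x; last by rewrite flat0 // mulr_ge0.
rewrite /flat x0 gtr0_norm //.
have y0 : 0 < x^-1 by rewrite invr_gt0.
have := expR_ge1Dxn n (ltW y0); set e := expR _ => he.
have e0 : 0 < e by exact: expR_gt0.
have h : x^-1 ^+ n.+1 <= n.+1`!%:R * e.
  have F0 : 0 < (n.+1`!%:R : R) by rewrite ltr0n fact_gt0.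
  rewrite mulrC -ler_pdivrMr //; apply: le_trans he; lra.
rewrite expRN -/e ler_pdivrMr // mulrAC.
apply: le_trans (ler_wpM2r (ltW x0) h).
by rewrite exprS mulrC mulrA divff ?mul1r // gt_eqF.
Qed.

Lemma near_is_derive f g x l : {near x, f =1 g} -> is_derive x (1 : R) f l ->
  is_derive x (1 : R) g l.
Proof.
move=> fg df; apply: DeriveDef; first by apply: near_eq_derivable fg _; case: df.
by rewrite -(near_eq_derive _ fg) derive_val.
Qed.

Lemma is_derive_flat n x :
  is_derive x (1 : R) (flat n) (flat n.+2 x - n%:R * flat n.+1 x).
Proof.
have [x0|x0|<-] := ltgtP 0 x.
- apply: (@near_is_derive (fun y => y^-1 ^+ n * expR (- y^-1))).
    by near=> y; rewrite /flat ifT //; near: y; exact: lt_nbhsr.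
  rewrite /flat x0.
  have xN0 : x != 0 by rewrite gt_eqF.
  have d1 : is_derive x (1 : R) (fun y : R => y^-1) (- x ^- 2).
    apply: (is_derive_eq (is_deriveV xN0 (is_derive_id x (1 : R)))).
    by rewrite /GRing.scale /= mulr1.
  have d2 : is_derive x (1 : R) (fun y : R => expR (- y^-1)) (expR (- x^-1) * (x ^- 2)).
    apply: (is_derive_eq (is_derive1_comp (is_derive_expR _) (is_deriveN d1))).
    by rewrite opprK.
  have d3 := is_deriveX n d1.
  have -> : (fun y : R => y^-1 ^+ n * expR (- y^-1)) =
      (fun y : R => y^-1) ^+ n * (fun y : R => expR (- y^-1)).
    by apply/funext => y; rewrite mulrfctE exprfctE.
  apply: (is_derive_eq (is_deriveM d3 d2)).
  rewrite /GRing.scale /= exprfctE -exprVn; case: n {d3} => [|n].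
    by rewrite !mul0r subr0 mulr0 addr0 expr0 mul1r; ring.
  by rewrite -pred_Sn !exprS; ring.
- apply: (@near_is_derive (fun=> 0)).
    near=> y; rewrite flat0 //; apply: ltW; near: y; exact: lt_nbhsl.
  by apply: (is_derive_eq (is_derive_cst _ _ _)); rewrite !flat0 ?ltW // mulr0 subr0.
- rewrite !flat0 // mulr0 subr0.
  suff cv : (fun h : R => h^-1 *: ((flat n \o shift 0) (h *: (1 : R)) - flat n 0)) @ 0^' -->
    (0 : R).
    by apply: DeriveDef; [apply/cvg_ex; exists 0|exact/cvg_lim].
  apply/cvgrPdist_le => e e0.
  near=> h; rewrite sub0r normrN /= addr0 [h *: 1]mulr1 (flat0 _ (lexx 0)) subr0.
  (* The difference quotient at 0 is the next function of the family, which [flat_le] sends to 0. *)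
  have -> : h^-1 *: flat n h = flat n.+1 h.
    rewrite /flat; case: ifP => _; last by rewrite scaler0.
    by rewrite exprS -mulrA.
  rewrite ger0_norm ?flat_ge0 //; apply: le_trans (flat_le _ _) _.
  rewrite -ler_pdivlMl ?ltr0n ?fact_gt0 //.
  near: h; apply: dnbhs0_le; rewrite mulr_gt0 // invr_gt0 ltr0n fact_gt0 //.
Unshelve. all: by end_near. Qed.

Lemma smooth_flat n : smooth (flat n).
Proof.
move=> k; elim: k n => [|k IH] n.
  by apply: derivable_cont => x; case: (is_derive_flat n x).
apply: (Ck_step (is_derive_flat n)).
apply: CkD => //; have -> : (fun x => - (n%:R * flat n.+1 x)) = (fun x => (- n%:R) * flat n.+1 x).
  by apply/funext => x; rewrite mulNr.
by apply: CkM => //; exact: Ck_cst.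
Qed.

End Flat.

(** * Smooth steps and diffeomorphisms stretching the unit interval *)

Section Step.
Local Open Scope ring_scope.
Context {R : realType}.
Implicit Types (x y c : R) (f g : R -> R).

(** A smooth transition from 0 on the left of 0 to 1 on the right of 1; the two terms of the
    denominator never vanish together. *)
Definition step x := flat 0 x / (flat 0 x + flat 0 (1 - x)).

Lemma step_den_gt0 x : 0 < flat 0 x + flat 0 (1 - x).
Proof.
have [x0|x0] := ltP 0 x; first by rewrite ltr_wpDr ?flat_ge0 ?flat_gt0.
by rewrite ltr_wpDl ?flat_ge0 ?flat_gt0 //; lra.
Qed.

Lemma step_le0 x : x <= 0 -> step x = 0.
Proof. by move=> x0; rewrite /step flat0 // mul0r. Qed.

Lemma step_ge1 x : 1 <= x -> step x = 1.
Proof.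
move=> x1; have := step_den_gt0 x; rewrite /step (flat0 _ (_ : 1 - x <= 0)) ?subr_le0 //.
by rewrite addr0 => h; rewrite divff // gt_eqF.
Qed.

Lemma step_ge0 x : 0 <= step x.
Proof. by rewrite divr_ge0 ?flat_ge0 // ltW // step_den_gt0. Qed.

Lemma step_le1 x : step x <= 1.
Proof. by rewrite ler_pdivrMr ?step_den_gt0 // mul1r lerDl flat_ge0. Qed.

Lemma smooth_step : smooth step.
Proof.
move=> k; apply: CkM; first exact: smooth_flat.
apply: CkV => [x|]; first by rewrite gt_eqF // step_den_gt0.
apply: CkD; first exact: smooth_flat.
apply: Ck_comp; first exact: smooth_flat.
rewrite (_ : (fun x : R => 1 - x) = (fun x => 1 + (- 1) * x)); last first.
  by apply/funext => x; rewrite mulN1r.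
apply: CkD; first exact: Ck_cst.
by apply: CkM; [exact: Ck_cst|exact: Ck_id].
Qed.

(** By the quotient rule the numerator is [p * q' + q * p'], where [p'] and [q'] are the derivatives
    of [flat 0] at [x] and [1 - x], both values of [flat 2]. *)
Lemma derive_step_ge0 x : 0 <= derive1 step x.
Proof.
set p := flat 0 x; set q := flat 0 (1 - x).
set p' := flat 2 x - 0%:R * flat 1 x; set q' := flat 2 (1 - x) - 0%:R * flat 1 (1 - x).
have pq : p + q != 0 by rewrite gt_eqF // step_den_gt0.
have dp : is_derive x (1 : R) (flat 0) p' by exact: is_derive_flat.
have d1 : is_derive x (1 : R) (fun x => 1 - x) (- 1).
  by apply: (is_derive_eq (is_deriveB (is_derive_cst _ _ _) (is_derive_id x (1 : R))));
    rewrite sub0r.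
have dq : is_derive x (1 : R) (fun x => flat 0 (1 - x)) (q' * - 1).
  exact: (@is_derive1_comp _ (flat 0) (fun x => 1 - x) _ _ _ (is_derive_flat 0 (1 - x)) d1).
have ds := is_deriveM dp (is_deriveV (f := fun x => flat 0 x + flat 0 (1 - x)) pq
  (is_deriveD dp dq)).
rewrite derive1E (derive_val (is_derive := ds)) /GRing.scale /= -/p -/q.
have p0 : 0 <= p by exact: flat_ge0.
have q0 : 0 <= q by exact: flat_ge0.
have p0' : 0 <= p' by rewrite /p' mul0r subr0 flat_ge0.
have q0' : 0 <= q' by rewrite /q' mul0r subr0 flat_ge0.
have -> : p * (- (p + q) ^- 2 * (p' + q' * -1)) + (p + q)^-1 * p' =
  (p * q' + q * p') / (p + q) ^+ 2 by field.
by rewrite divr_ge0 ?sqr_ge0 // addr_ge0 // mulr_ge0.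
Qed.

Lemma increasing_cancel f g : cancel f g -> cancel g f ->
  {homo f : x y / x < y} -> {homo g : x y / x < y}.
Proof.
move=> fK gK fm x y xy; rewrite ltNge; apply/negP; rewrite le_eqVlt => /orP[/eqP e|/fm].
  by move: xy; rewrite -(gK x) -(gK y) e ltxx.
by rewrite !gK => /(lt_trans xy); rewrite ltxx.
Qed.

(** The derivative is at least 1, so [f] is strictly increasing and [Ck_inverse] applies.
    Surjectivity is the intermediate value theorem on [[y - a, y]], as [step] takes values between 0
    and 1. *)
Lemma step_diffeo a b : 0 <= a -> 0 < b -> let f x := x + a * step (b * x) in
  exists g, [/\ smooth f, smooth g, cancel f g, cancel g f & {homo f : x y / x < y}].
Proof.
move=> a0 b0 f.
have sf : smooth f.
  move=> k; apply: CkD; first exact: Ck_id.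
  apply: CkM; first exact: Ck_cst.
  apply: Ck_comp; first exact: smooth_step.
  by apply: CkM; [exact: Ck_cst|exact: Ck_id].
have cf : continuous f by exact: (sf 0%N).
have f'1 x : 1 <= derive1 f x.
  have [ds _] := CkP (smooth_step 1).
  have dl : is_derive x (1 : R) (fun x => b * x) b.
    by apply: (is_derive_eq (is_deriveZ b (is_derive_id x (1 : R)))); rewrite /GRing.scale /= mulr1.
  have dc : is_derive x (1 : R) (fun x => step (b * x)) (derive1 step (b * x) * b).
    exact: (@is_derive1_comp _ step (fun x => b * x) _ _ _ (ds _) dl).
  have df := is_deriveD (is_derive_id x (1 : R)) (is_deriveZ a dc).
  rewrite derive1E (derive_val (is_derive := df)) /GRing.scale /= lerDl.
  by rewrite !mulr_ge0 ?derive_step_ge0 // ltW.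
have fm : {homo f : x y / x < y}.
  move=> x y xy.
  have [c _ e] : exists2 c, c \in `]x, y[ & f y - f x = derive1 f c * (y - x).
    apply: MVT; first exact: xy.
      by move=> z _; have [df _] := CkP (sf 1%N); exact: df.
    exact: continuous_subspaceT.
  by rewrite -subr_gt0 e mulr_gt0 ?subr_gt0 // (lt_le_trans _ (f'1 c)).
have [g gK] : {g | cancel g f}.
  suff /choice[g gP] : forall y, exists x, f x = y by exists g.
  move=> y; suff [x _ fx] : exists2 x, x \in `[y - a, y] & f x = y by exists x.
  apply: IVT; first by rewrite lerBlDr lerDl.
    exact: continuous_subspaceT.
  rewrite /f ge_min le_max; apply/andP; split; apply/orP; [left|right].
    have := step_le1 (b * (y - a)) => h.
    by have := ler_wpM2l a0 h; lra.
  by rewrite lerDl mulr_ge0 ?step_ge0.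
have fK : cancel f g.
  move=> x; have [h|h|//] := ltgtP (g (f x)) x.
    by have := fm _ _ h; rewrite gK ltxx.
  by have := fm _ _ h; rewrite gK ltxx.
exists g; split => // k; apply: CkS; apply: (Ck_inverse fK gK) => // x.
by rewrite gt_eqF // (lt_le_trans _ (f'1 x)).
Qed.

Lemma exists_stretch c : 0 < c -> exists GH : (R -> R) * (R -> R),
  [/\ smooth GH.1, smooth GH.2, cancel GH.1 GH.2, cancel GH.2 GH.1 &
    [/\ {homo GH.1 : x y / x < y}, forall x, x <= 0 -> GH.1 x = x
      & forall x, 1 <= x -> GH.1 x = x + (c - 1)]].
Proof.
move=> c0; have [c1|c1] := leP 1 c.
  have [||g [sf sg fK gK fm]] := @step_diffeo (c - 1) 1; [by rewrite subr_ge0|exact: ltr01|].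
  eexists (_, g); split; [exact: sf|exact: sg|exact: fK|exact: gK|split => //= x x0].
    by rewrite step_le0 ?mul1r // mulr0 addr0.
  by rewrite step_ge1 ?mul1r // mulr1.
(* For [c < 1] the inverse is used: with scale [c^-1] the direct map carries [[0, c]] onto [[0, 1]],
   so its inverse is already a translation from 1 on. *)
have [||g [sf sg fK gK fm]] := @step_diffeo (1 - c) c^-1;
  [by rewrite subr_ge0 ltW|by rewrite invr_gt0|].
eexists (g, _); split; [exact: sg|exact: sf|exact: gK|exact: fK|split => [|x x0|x x1] /=].
- exact: increasing_cancel fK gK fm.
- rewrite -[X in g X](_ : x + (1 - c) * step (c^-1 * x) = x) ?fK //.
  by rewrite step_le0 ?mulr0 ?addr0 // pmulr_rle0 // invr_gt0.
- rewrite -[X in g X](_ : (x + (c - 1)) + (1 - c) * step (c^-1 * (x + (c - 1))) = x) ?fK //.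
  rewrite step_ge1 ?mulr1; first lra.
  by rewrite ler_pdivlMl // mulr1; lra.
Qed.

End Step.

(** * Coherent families of normal functions *)

Section Normal.
Local Open Scope ring_scope.
Context (R : realType) (d : Order.disp_t) (W : orderType d) (hW : is_omega1 W).
Implicit Types (x y z a b c : W) (P Q S : W -> R).

Local Notation succ := (succ hW).
Local Notation bot := (bot hW).
Local Notation limit := (limit hW).

(* [P x] is meant as the coordinate of the point [(x, 0)] of the long ray, and [inc P x]
   as the length of the image of the interval from [(x, 0)] to [(succ x, 0)]. *)
Definition inc P x := P (succ x) - P x.

(** The second clause is continuity at limits from below; together with monotonicity it says that
    [P l] is the supremum of the earlier values. *)
Definition normal a b P :=
  (forall x y, (a <= x)%O -> (x < y)%O -> (y <= b)%O -> P x < P y) /\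
  (forall l, limit l -> (a < l)%O -> (l <= b)%O ->
     forall e, 0 < e -> exists x, [/\ (a <= x)%O, (x < l)%O & P l - P x < e]).

(** Coherence modulo finite compares increments rather than values, and is therefore insensitive to
    translations of [P] and [Q]. *)
Definition coh a b P Q :=
  finite_set [set x | [/\ (a <= x)%O, (x < b)%O & inc P x <> inc Q x]].

Definition glue b P Q x := if (x <= b)%O then P x else Q x.

Lemma normal_sub a b a' b' P : (a <= a')%O -> (b' <= b)%O ->
  normal a b P -> normal a' b' P.
Proof.
move=> aa bb [m c]; split.
  by move=> x y ax xy yb; apply: m => //; [exact: le_trans ax|exact: le_trans bb].
move=> l ll al lb e e0.
have [|x [ax xl h]] := c l ll _ (le_trans lb bb) e e0; first exact: le_lt_trans aa al.
exists (Order.max x a'); split; first by rewrite le_max lexx orbT.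
  by rewrite gt_max xl.
apply: le_lt_trans h; rewrite lerD2l lerN2.
case: (leP a' x) => // xa; apply: ltW; apply: m => //.
by apply: (le_trans _ bb); exact: ltW (lt_le_trans al lb).
Qed.

Lemma normal_eq a b P Q : (forall x, (a <= x)%O -> (x <= b)%O -> P x = Q x) ->
  normal a b P -> normal a b Q.
Proof.
move=> e [m c]; split.
  move=> x y ax xy yb; have xb := le_trans (ltW xy) yb.
  by have ay := le_trans ax (ltW xy); rewrite -!e //; exact: m.
move=> l ll al lb ep ep0; have [x [ax xl h]] := c l ll al lb ep ep0.
have xb := le_trans (ltW xl) lb; have al' := ltW al.
by exists x; split => //; rewrite -!e.
Qed.

Lemma normalD a b P (r : R) : normal a b P -> normal a b (fun x => P x + r).
Proof.
move=> [m c]; split; first by move=> x y ax xy yb; rewrite ltrD2r; exact: m.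
move=> l ll al lb e e0; have [x [ax xl h]] := c l ll al lb e e0.
by exists x; split => //; have -> : P l + r - (P x + r) = P l - P x by ring.
Qed.

Lemma normal_bot P : normal bot bot P.
Proof.
split; first by move=> x y _ /lt_le_trans h /h; rewrite ltNge bot_le.
by move=> l _ /lt_le_trans h /h; rewrite ltxx.
Qed.

Lemma normal_succ a P : P a < P (succ a) -> normal a (succ a) P.
Proof.
move=> h; split => [x y ax xy yb|l ll al]; last first.
  rewrite le_eqVlt lt_succE leNgt al orbF => /eqP e.
  by case: (@succ_not_limit _ _ hW a); rewrite -e.
have xa : x = a.
  by apply/eqP; rewrite eq_le ax andbT -(lt_succE hW) (lt_le_trans xy).
have ya : y = succ a by apply/eqP; rewrite eq_le yb succ_le -xa.
by rewrite xa ya.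
Qed.

Lemma normal_glue a b c P Q : (a <= b)%O -> (b <= c)%O -> P b = Q b ->
  normal a b P -> normal b c Q -> normal a c (glue b P Q).
Proof.
move=> ab bc e [mP cP] [mQ cQ]; rewrite /glue; split.
  move=> x y ax xy yc; case: (leP y b) => yb.
    by rewrite (le_trans (ltW xy) yb); exact: mP.
  case: (leP x b) => xb; last by apply: mQ => //; exact: ltW.
  have h : Q b < Q y by apply: mQ.
  move: xb; rewrite le_eqVlt => /orP[/eqP ->|xb]; first by rewrite e.
  by apply: lt_trans h; rewrite -e; apply: mP.
move=> l ll al lc ep ep0; case: (leP l b) => lb.
  have [x [ax xl h]] := cP l ll al lb ep ep0; exists x; split => //.
  by rewrite (le_trans (ltW xl) lb).
have [x [bx xl h]] := cQ l ll lb lc ep ep0; exists x; split => //.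
  exact: le_trans ab bx.
case: ifP => // xb; suff <- : b = x by rewrite e; move: h; suff -> : x = b by [];
  apply/eqP; rewrite eq_le bx xb.
by apply/eqP; rewrite eq_le bx xb.
Qed.

Lemma inc_glue_l b P Q x : (x < b)%O -> inc (glue b P Q) x = inc P x.
Proof. by move=> xb; rewrite /inc /glue succ_le xb (ltW xb). Qed.

Lemma inc_glue_r b P Q x : P b = Q b -> (b <= x)%O -> inc (glue b P Q) x = inc Q x.
Proof.
move=> e bx; rewrite /inc /glue succ_le ltNge bx /=.
case: ifP => // xb; congr (_ - _).
by suff -> : x = b by []; apply/eqP; rewrite eq_le bx xb.
Qed.

Lemma incD P (r : R) x : inc (fun x => P x + r) x = inc P x.
Proof. by rewrite /inc; ring. Qed.

Lemma coh_eq a b P Q : (forall x, (a <= x)%O -> (x < b)%O -> inc P x = inc Q x) ->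
  coh a b P Q.
Proof.
move=> e; apply: (sub_finite_set _ (@finite_set0 W)) => x /= [ax xb].
by rewrite e.
Qed.

Lemma coh_sym a b P Q : coh a b P Q -> coh a b Q P.
Proof. by apply: sub_finite_set => x /= [ax xb h]; split => // e; apply: h. Qed.

Lemma coh_trans a b Q P S : coh a b P Q -> coh a b Q S -> coh a b P S.
Proof.
move=> f1 f2; have f : finite_set ([set x | [/\ (a <= x)%O, (x < b)%O & inc P x <> inc Q x]]
  `|` [set x | [/\ (a <= x)%O, (x < b)%O & inc Q x <> inc S x]]) by rewrite finite_setU.
apply: sub_finite_set f => x /= [ax xb h].
have [e|e] := pselect (inc P x = inc Q x); last by left.
by right; split => //; rewrite -e.
Qed.

Lemma coh_sub a b a' b' P Q : (a <= a')%O -> (b' <= b)%O ->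
  coh a b P Q -> coh a' b' P Q.
Proof.
move=> aa bb; apply: sub_finite_set => x /= [ax xb h]; split => //.
  exact: le_trans ax.
exact: lt_le_trans bb.
Qed.

Lemma coh_cat b a c P Q : coh a b P Q -> coh b c P Q -> coh a c P Q.
Proof.
move=> f1 f2; have f : finite_set ([set x | [/\ (a <= x)%O, (x < b)%O & inc P x <> inc Q x]]
  `|` [set x | [/\ (b <= x)%O, (x < c)%O & inc P x <> inc Q x]]) by rewrite finite_setU.
apply: sub_finite_set f => x /= [ax xc h].
by have [xb|xb] := ltP x b; [left|right].
Qed.

Lemma coh_succ a P Q : coh a (succ a) P Q.
Proof.
apply: (sub_finite_set _ (finite_set1 a)) => x /= [ax + _].
by rewrite lt_succE => xa; apply/eqP; rewrite eq_le ax xa.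
Qed.

(* Finitely many jumps suffice to prescribe the total variation, because at a limit
   the tail of [P] is already small. *)
Lemma modify a b P (s : R) : (a < b)%O -> normal a b P -> 0 < s ->
  exists Q, [/\ normal a b Q, Q a = 0, Q b = s & coh a b P Q].
Proof.
elim/(well_founded_ind (lt_wf hW)): b s => b IH s ab nP s0.
have [eb|[c eb]|lb] := bot_succ_limit hW b.
- by move: ab; rewrite eb ltNge bot_le.
- have [|ca] := ltP a c; last first.
    have {ca} ca : c = a.
      by apply/eqP; rewrite eq_le ca -(lt_succE hW) -eb ab.
    subst c; subst b; exists (fun x => if (x <= a)%O then 0 else s).
    have ns : (succ a <= a)%O = false by rewrite succ_le ltxx.
    split; rewrite ?lexx ?ns //; last exact: coh_succ.
    by apply: normal_succ; rewrite lexx ns.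
  move=> ac; have cb : (c < b)%O by rewrite eb lt_succ.
  have s2 : 0 < s / 2 by rewrite divr_gt0.
  have [Q [nQ Qa Qc hQ]] := IH c cb _ ac (normal_sub (lexx _) (ltW cb) nP) s2.
  pose S x := if (x <= c)%O then s / 2 else s.
  have ns : (succ c <= c)%O = false by rewrite succ_le ltxx.
  have e : Q c = S c by rewrite /S lexx.
  exists (glue c Q S); split.
  + apply: normal_glue => //; [exact: ltW|exact: ltW|].
    by rewrite eb; apply: normal_succ; rewrite /S lexx ns; lra.
  + by rewrite /glue (ltW ac).
  + by rewrite /glue /S eb ns.
  + apply: (@coh_cat c); last by rewrite eb; exact: coh_succ.
    apply: coh_trans hQ _; apply: coh_eq => x _ xc.
    by rewrite inc_glue_l.
- have [m cP] := nP.
  (* From some [x] on, [P] climbs by less than [s]. Its increments are kept beyond [c], and the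
     induction hypothesis at [c] supplies the missing [s - (P b - P c)]; the maximum with [succ a]
     ensures [a < c]. *)
  have [x [ax xb hx]] := cP b lb ab (lexx b) s s0.
  pose c := Order.max x (succ a).
  have sab : (succ a < b)%O by case: lb => _; apply.
  have cb : (c < b)%O by rewrite /c gt_max xb.
  have ac : (a < c)%O by rewrite /c lt_max lt_succ orbT.
  have hc : P b - P c < s.
    apply: le_lt_trans hx; rewrite lerD2l lerN2.
    rewrite /c; case: (leP (succ a) x) => // xsa; apply/ltW/m => //; exact: ltW.
  have s2 : 0 < s - (P b - P c) by rewrite subr_gt0.
  have [Q [nQ Qa Qc hQ]] := IH c cb _ ac (normal_sub (lexx _) (ltW cb) nP) s2.
  pose S x := P x + (s - P b).
  have e : Q c = S c by rewrite Qc /S; ring.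
  exists (glue c Q S); split.
  + apply: normal_glue => //; [exact: ltW|exact: ltW|].
    by apply: normalD; apply: normal_sub nP => //; exact: ltW.
  + by rewrite /glue (ltW ac).
  + by rewrite /glue leNgt cb /= /S; ring.
  + apply: (@coh_cat c).
      by apply: coh_trans hQ _; apply: coh_eq => y _ yc; rewrite inc_glue_l.
    by apply: coh_eq => y cy _; rewrite inc_glue_r // incD.
Qed.

(** * Extending a coherent family to a limit with a prescribed rate *)

Section Limit.
Context (F : W -> W -> R) (a : W) (u : nat -> W) (t : nat -> R).
Context (lad : ladder hW a u).
Context (t0 : forall n, 0 < t n).
Context (tlt : forall n, t n.+1 < t n).
Context (tlim : forall e, 0 < e -> exists n, t n < e).
Context (nF : forall b, (b < a)%O -> normal bot b (F b)).
Context (cF : forall c b, (c < b)%O -> (b < a)%O -> coh bot c (F c) (F b)).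

(** A candidate up to [u n], normalised so that the value at [a] will be 0. *)
Let stage n P :=
  [/\ normal bot (u n) P, P (u n) = - t n & coh bot (u n) (F (u n)) P].

(** Between [u n] and [u n.+1] the function [F (u n.+1)] is altered by [modify] to climb by exactly
    [t n - t n.+1], at the cost of finitely many increments. *)
Let stage_next n P : stage n P ->
  exists Q, stage n.+1 Q /\ forall x, (x <= u n)%O -> Q x = P x.
Proof.
move=> [nP Pu hP]; have [u0 ult ua ucof] := lad.
have [|Q [nQ Q0 Q1 hQ]] := modify (ult n) (normal_sub (bot_le _ _) (lexx _) (nF (ua n.+1))) (s
  := t n - t n.+1).
  by rewrite subr_gt0.
pose S x := Q x + (- t n).
have e : P (u n) = S (u n) by rewrite Pu /S Q0 add0r.
exists (glue (u n) P S); split; last by move=> x xu; rewrite /glue xu.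
split.
- apply: normal_glue => //; [exact: bot_le|exact: ltW|exact: normalD].
- by rewrite /glue leNgt ult /= /S Q1; ring.
- apply: (@coh_cat (u n)).
    apply: (coh_trans (coh_sym (cF (ult n) (ua n.+1)))).
    apply: (coh_trans hP); apply: coh_eq => x _ xu.
    by rewrite inc_glue_l.
  apply: (coh_trans hQ); apply: coh_eq => x ux _.
  by rewrite inc_glue_r // incD.
Qed.

(** Each stage extends the preceding one, so together they define [P] below [a]; continuity at [a]
    holds because [t] tends to 0. For [b < u n], coherence of [F b] with [P] passes through
    [F (u n)] and stage [n], so only finitely many steps contribute exceptions. *)
Lemma extend_limit : exists P, [/\ normal bot a P,
  forall b, (b < a)%O -> coh bot b (F b) P
  & forall n, P a - P (u n) = t n].
Proof.
have [u0 ult ua ucof] := lad.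
have /choice[f fP] : forall nP : nat * (W -> R), exists Q, stage nP.1 nP.2 ->
    stage nP.1.+1 Q /\ forall x, (x <= u nP.1)%O -> Q x = nP.2 x.
  move=> [n P] /=; have [/stage_next[Q hQ]|?] := pselect (stage n P); first by exists Q.
  by exists P.
pose p := fix p n := if n is m.+1 then f (m, p m) else fun=> - t 0.
have st n : stage n (p n).
  elim: n => [|n IH]; last by have [] := fP (n, p n) IH.
  split => //=; rewrite u0; first exact: normal_bot.
  by apply: coh_eq => x _; rewrite ltNge bot_le.
have agS n x : (x <= u n)%O -> p n.+1 x = p n x by have [_] := fP (n, p n) (st n); exact.
have ule m n : (m <= n)%N -> (u m <= u n)%O.
  by apply: (homo_leq lexx le_trans) => k; exact: ltW.
have ag m n x : (m <= n)%N -> (x <= u m)%O -> p n x = p m x.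
  elim: n => [|n IH]; first by rewrite leqn0 => /eqP ->.
  rewrite leq_eqVlt => /orP[/eqP->//|mn] xu.
  by rewrite agS ?IH //; apply: le_trans xu _; apply: ule.
have /choice[nn nnP] : forall x, exists n, (x < a)%O -> (x < u n)%O.
  move=> x; have [/ucof[n xn]|?] := boolP (x < a)%O; first by exists n.
  by exists 0%N.
pose P x := if (x < a)%O then p (nn x) x else 0.
have Pp n x : (x <= u n)%O -> p n x = P x.
  move=> xu; have xa : (x < a)%O by apply: le_lt_trans xu (ua n).
  rewrite /P xa; have xn := ltW (nnP x xa).
  by have [h|h] := leqP n (nn x); [rewrite (ag _ _ _ h)|rewrite -(ag _ _ _ (ltnW h))].
have nPn n : normal bot (u n) P.
  by have [nP _ _] := st n; apply: normal_eq nP => x _; exact: Pp.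
have Pa : P a = 0 by rewrite /P ltxx.
have Pu n : P (u n) = - t n by rewrite -(Pp n) //; case: (st n).
exists P; split.
- split=> [x y _ xy ya|l ll bl].
    have [ya'|ay] := ltP y a.
      have [n yn] := ucof y ya'; have [m _] := nPn n; apply: m => //.
        exact: bot_le.
      exact: ltW.
    have {ya ay} e : y = a by apply/eqP; rewrite eq_le ya ay.
    subst y; have [n xn] := ucof x xy; have [m _] := nPn n.
    have := m x (u n) (bot_le _ _) xn (lexx _); rewrite Pu Pa => /lt_trans; apply.
    by rewrite oppr_lt0.
  rewrite le_eqVlt => /orP[/eqP -> e e0|la].
    have [n tn] := tlim e0; exists (u n); split => //; first exact: bot_le.
    by rewrite Pu Pa sub0r opprK.
  have [n ln] := ucof l la; have [_ c] := nPn n.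
  exact: c l ll bl (ltW ln).
- move=> b /[dup] ba /ucof[n bn].
  apply: (coh_trans (cF bn (ua n))).
  have [_ _ hn] := st n; apply: (coh_sub (lexx _) (ltW bn)).
  apply: (coh_trans hn); apply: coh_eq => x _ xu; rewrite /inc.
  by rewrite !Pp // ?succ_le // ltW.
- by move=> n; rewrite Pu Pa sub0r opprK.
Qed.

End Limit.

(** Transfinite recursion: a constant at [bot], one more increment at a successor, and
    [extend_limit] at a limit. *)
Lemma coherent_family (L : W -> nat -> W) (T : W -> nat -> R) :
  (forall a, limit a -> ladder hW a (L a)) ->
  (forall a n, 0 < T a n) -> (forall a n, T a n.+1 < T a n) ->
  (forall a e, 0 < e -> exists n, T a n < e) ->
  exists F : W -> W -> R, forall a, [/\ normal bot a (F a),
    forall b, (b < a)%O -> coh bot b (F b) (F a)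
    & limit a -> forall n, F a a - F a (L a n) = T a n].
Proof.
move=> lad T0 Tlt Tlim.
pose good a (F : W -> W -> R) P := [/\ normal bot a P,
    forall b, (b < a)%O -> coh bot b (F b) P
    & limit a -> forall n, P a - P (L a n) = T a n].
have step a F : (forall b, (b < a)%O -> good b F (F b)) -> exists P, good a F P.
  move=> h.
  have nF b : (b < a)%O -> normal bot b (F b) by move=> /h[].
  have cF c b : (c < b)%O -> (b < a)%O -> coh bot c (F c) (F b).
    by move=> cb /h[_ + _]; exact.
  have [ea|[c ea]|la] := bot_succ_limit hW a.
  - subst a; exists (fun=> 0); split; first exact: normal_bot.
      by move=> b; rewrite ltNge bot_le.
    by move=> [+ _]; rewrite ltxx.
  - have ca : (c < a)%O by rewrite ea lt_succ.
    have ns : (succ c <= c)%O = false by rewrite succ_le ltxx.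
    (* The new last interval is given length 1. *)
    pose P := glue c (F c) (fun x => if (x <= c)%O then F c c else F c c + 1).
    have cP : coh bot c (F c) P by apply: coh_eq => x _ xc; rewrite inc_glue_l.
    exists P; split.
    + apply: normal_glue; [exact: bot_le|exact: ltW|by rewrite lexx|exact: nF|].
      by rewrite ea; apply: normal_succ; rewrite lexx ns ltrDl.
    + move=> b; rewrite {1}ea lt_succE le_eqVlt => /orP[/eqP -> //|bc].
      by apply: (coh_trans (cF b c bc ca)); apply: coh_sub cP => //; exact: ltW.
    + by rewrite ea => /succ_not_limit.
  - have [P [nP cP tP]] := extend_limit (lad a la) (T0 a) (Tlt a) (Tlim a) nF cF.
    by exists P.
(* The recursor supplies values below [a] only; padding with 0 makes them a total family, to which
   [good] applies. *)
pose ext a (f : forall b, (b < a)%O -> W -> R) : W -> W -> R := fun b =>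
  if pselect (b < a)%O is left h then f b h else fun=> 0.
pose G a (f : forall b, (b < a)%O -> W -> R) : W -> R :=
  xget (fun=> 0) [set P | good a (ext a f) P].
pose F := Fix (lt_wf hW) (fun=> W -> R) G.
have FE a : F a = G a (fun b _ => F b).
  rewrite /F Fix_eq // => {}a f g fg; congr (G a _).
  by apply/functional_extensionality_dep => b; apply/functional_extensionality_dep => h.
have goodE a F1 F2 P : (forall b, (b < a)%O -> F1 b = F2 b) -> good a F1 P -> good a F2 P.
  by move=> e [h1 h2 h3]; split => // b ba; rewrite -e //; exact: h2.
have goodF a : good a F (F a).
  elim/(well_founded_ind (lt_wf hW)): a => a IH.
  have e b : (b < a)%O -> F b = ext a (fun b _ => F b) b.
    by move=> ba; rewrite /ext; case: pselect.
  have [P gP] := step a F IH.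
  rewrite FE /G; case: xgetP => [Q _ gQ|/(_ P)].
  by apply: goodE gQ => b ba; rewrite -e.
  by case; apply: goodE gP => b /e.
by exists F => a; have [] := goodF a.
Qed.

End Normal.

(** * Coordinates on the long ray *)

Section Coordinate.
Local Open Scope ring_scope.
Context (R : realType) (d : Order.disp_t) (W : orderType d) (hW : is_omega1 W).
Implicit Types (x y z a b : W) (P Q S : W -> R) (p q : Lge0 R W).

Local Notation succ := (succ hW).
Local Notation bot := (bot hW).
Local Notation limit := (limit hW).
Local Notation normal := (normal hW).
Local Notation coh := (coh hW).
Local Notation inc := (inc hW).

Definition is_stretch (c : R) (G H : R -> R) :=
  [/\ smooth G, smooth H, cancel G H, cancel H G &
    [/\ {homo G : s t / s < t}, forall t, t <= 0 -> G t = t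
      & forall t, 1 <= t -> G t = t + (c - 1)]].

Lemma exists_stretches : exists GH : R -> (R -> R) * (R -> R),
  forall c : R, 0 < c -> is_stretch c (GH c).1 (GH c).2.
Proof.
suff /choice[GH hGH] : forall c : R, exists GH : (R -> R) * (R -> R),
  0 < c -> is_stretch c GH.1 GH.2 by exists GH.
move=> c; have [c0|?] := ltP 0 c; last by exists (id, id).
by have [GH ?] := exists_stretch c0; exists GH.
Qed.

(** One diffeomorphism is fixed for each length, so that equal increments give the same
    parametrisation of the interval. *)
Definition stretch (r : R) := (sval (cid exists_stretches) r).1.
Definition unstretch (r : R) := (sval (cid exists_stretches) r).2.

Lemma stretchP (r : R) : 0 < r -> is_stretch r (stretch r) (unstretch r).
Proof. exact: (svalP (cid exists_stretches)). Qed.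

(** A linear rescaling of each interval would leave kinks at its ends when its length is changed; a
    stretch continues smoothly by translations on both sides. *)
Definition phi P p : R := P p.1 + stretch (inc P p.1) (val p.2).

Lemma ltLge0 p q : (p < q)%O = (p.1 < q.1)%O || (p.1 == q.1) && (val p.2 < val q.2).
Proof.
rewrite Order.ProdLexiOrder.ltEprodlexi.
by case: (ltgtP p.1 q.1) => //= _.
Qed.

Lemma inc_gt0 (c : W) P x : normal bot c P -> (x < c)%O -> 0 < inc P x.
Proof.
move=> [m _] xc; rewrite subr_gt0; apply: m => //; first exact: bot_le.
  exact: lt_succ.
by rewrite succ_le.
Qed.

Lemma stretch_range (r t : R) : 0 < r -> 0 <= t < 1 -> 0 <= stretch r t < r.
Proof.
move=> /stretchP[_ _ _ _ [m s0 s1]] /andP[t0 t1].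
have /m h : t < 1 by [].
rewrite (s1 1) // in h; rewrite [X in _ && (_ < X)](_ : r = 1 + (r - 1)); last by ring.
rewrite h andbT; move: t0; rewrite le_eqVlt => /orP[/eqP <-|/m]; first by rewrite s0.
by rewrite s0 // => /ltW.
Qed.

Lemma phi_range c P p : normal bot c P -> (p.1 < c)%O ->
  P p.1 <= phi P p < P (succ p.1).
Proof.
move=> nP pc; have h : 0 <= val p.2 < 1 by exact: (valP p.2).
have := stretch_range (inc_gt0 nP pc) h; rewrite /phi /inc; lra.
Qed.

Lemma normal_le a c P x y : normal a c P -> (a <= x)%O -> (x <= y)%O ->
  (y <= c)%O -> P x <= P y.
Proof.
move=> [m _] ax; rewrite le_eqVlt => /orP[/eqP ->//|xy] yc.
exact/ltW/m.
Qed.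

Lemma phi_lt c P p q : normal bot c P -> (q.1 < c)%O -> (p < q)%O ->
  phi P p < phi P q.
Proof.
move=> nP qc; rewrite ltLge0 => /orP[pq|/andP[/eqP e h]].
  have /andP[_ h1] := phi_range nP (lt_trans pq qc).
  have /andP[h2 _] := phi_range nP qc.
  apply: (lt_le_trans h1); apply: le_trans h2.
  by apply: (normal_le nP) => //; [exact: bot_le|rewrite succ_le|exact: ltW].
rewrite /phi e ltrD2l; have [_ _ _ _ [m _ _]] := stretchP (inc_gt0 nP qc).
exact: m.
Qed.

Lemma phi_le c P p q : normal bot c P -> (q.1 < c)%O -> (p <= q)%O ->
  phi P p <= phi P q.
Proof.
move=> nP qc; rewrite le_eqVlt => /orP[/eqP -> //|pq].
exact/ltW/(phi_lt nP).
Qed.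

Lemma phi_lt_mono c P p q : normal bot c P -> (p.1 < c)%O -> (q.1 < c)%O ->
  (phi P p < phi P q) = (p < q)%O.
Proof.
move=> nP pc qc; apply/idP/idP => [h|]; last exact: phi_lt nP qc.
by rewrite ltNge; apply/negP => /(phi_le nP pc); rewrite leNgt h.
Qed.

Lemma phi_inj c P p q : normal bot c P -> (p.1 < c)%O -> (q.1 < c)%O ->
  phi P p = phi P q -> p = q.
Proof.
move=> nP pc qc e; have [h|h|//] := ltgtP p q.
  by have := phi_lt nP qc h; rewrite e ltxx.
by have := phi_lt nP pc h; rewrite e ltxx.
Qed.

(** The ordinal of the preimage is the least [b] with [v < P (succ b)]. That [P b <= v] follows from
    minimality when [b] is a successor and from continuity of [P] when it is a limit; the second
    coordinate is then found by [unstretch]. *)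
Lemma phi_surj c P p q (v : R) : normal bot c P -> (p.1 < c)%O -> (q.1 < c)%O ->
  phi P p <= v -> v <= phi P q -> exists w : Lge0 R W, (w.1 < c)%O /\ phi P w = v.
Proof.
move=> nP pc qc pv vq.
have [b vb bmin] : exists2 b, v < P (succ b) &
    forall z, v < P (succ z) -> (b <= z)%O.
  apply: (least_element hW); exists q.1 => /=; apply: (le_lt_trans vq).
  by have /andP[] := phi_range nP qc.
have bc : (b < c)%O.
  apply: (le_lt_trans _ (qc)); apply: bmin; apply: (le_lt_trans vq).
  by have /andP[] := phi_range nP qc.
have [mP cP] := nP.
have bv : P b <= v.
  have [eb|[y eb]|lb] := bot_succ_limit hW b.
  - rewrite eb; have /andP[h _] := phi_range nP pc; apply: le_trans pv; apply: le_trans h.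
    by apply: (normal_le nP); [exact: bot_le|exact: bot_le|exact: ltW].
  - rewrite leNgt; apply/negP; rewrite eb => /bmin.
    by rewrite leNgt eb lt_succ.
  - rewrite leNgt; apply/negP => vPb.
    have [||x [_ xb hx]] := cP b lb _ (ltW bc) (P b - v); [by case: lb|by rewrite subr_gt0|].
    have : v < P (succ x).
      apply: (@lt_trans _ _ (P x)); first lra.
      apply: mP; [exact: bot_le|exact: lt_succ|].
      by rewrite succ_le; apply: lt_trans bc.
    by move=> /bmin; rewrite leNgt xb.
have i0 := inc_gt0 nP bc.
have [_ _ sK uK [m s0 s1]] := stretchP i0.
have um : {homo unstretch (inc P b) : s t / s < t} by exact: increasing_cancel sK uK m.
have u0 : unstretch (inc P b) 0 = 0 by rewrite -{1}(s0 0) ?sK.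
have u1 : unstretch (inc P b) (inc P b) = 1.
  by rewrite -[RHS](sK 1) s1 //; congr unstretch; ring.
have h : (0 <= unstretch (inc P b) (v - P b)) && (unstretch (inc P b) (v - P b) < 1).
  rewrite -[X in _ && (_ < X)]u1 um ?andbT; last by rewrite /inc; lra.
  move: bv; rewrite -subr_ge0 le_eqVlt => /orP[/eqP <-|/um]; first by rewrite u0.
  by rewrite u0 => /ltW.
exists (b, exist (fun r : R => (0 <= r) && (r < 1)) _ h : unit_itv R); split => //.
by rewrite /phi /= uK; ring.
Qed.

(** Transfinite induction: successors use the equal increments, and at a limit both functions are
    approximated at a common earlier point. *)
Lemma inc_eq_const a c P Q : normal a c P -> normal a c Q ->
  (forall x, (a <= x)%O -> (x < c)%O -> inc P x = inc Q x) ->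
  forall x, (a <= x)%O -> (x <= c)%O -> Q x = P x + (Q a - P a).
Proof.
move=> nP nQ e; elim/(well_founded_ind (lt_wf hW)) => x IH ax xc.
move: ax; rewrite le_eqVlt => /orP[/eqP <-|ax]; first by ring.
have [eb|[y ey]|lx] := bot_succ_limit hW x; first by move: ax; rewrite eb ltNge bot_le.
  have yx : (y < x)%O by rewrite ey lt_succ.
  have ay : (a <= y)%O by rewrite -(lt_succE hW) -ey.
  have := IH y yx ay (le_trans (ltW yx) xc); have := e y ay (lt_le_trans yx xc).
  by rewrite /inc -ey; lra.
apply/eqP; rewrite -subr_eq0 -normr_le0; apply/ler_addgt0Pl => r r0; rewrite addr0.
have [_ cP] := nP; have [_ cQ] := nQ.
have [y1 [ay1 y1x h1]] := cP x lx ax xc r r0.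
have [y2 [ay2 y2x h2]] := cQ x lx ax xc r r0.
pose y := Order.max y1 y2.
have ay : (a <= y)%O by rewrite le_max ay1.
have yx : (y < x)%O by rewrite gt_max y1x.
have yc := le_trans (ltW yx) xc.
have Py : P y1 <= P y by apply: (normal_le nP) yc; rewrite // le_max lexx.
have Qy : Q y2 <= Q y by apply: (normal_le nQ) yc; rewrite // le_max lexx orbT.
have Px := normal_le nP ay (ltW yx) xc; have Qx := normal_le nQ ay (ltW yx) xc.
have := IH y yx ay yc => ey.
by rewrite ler_norml; apply/andP; split; lra.
Qed.

(* Changing a single increment changes the coordinate by a global diffeomorphism of R:
   it is the identity to the left of the modified interval and a translation to its right. *)
Lemma transition1 c P x0 (r : R) : normal bot c P -> (x0 < c)%O -> 0 < r ->
  exists P' g, [/\ normal bot c P', inc P' x0 = r,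
    forall x, (x < c)%O -> x <> x0 -> inc P' x = inc P x, smooth g
    & forall p, (p.1 < c)%O -> g (phi P p) = phi P' p].
Proof.
move=> nP x0c r0; have [m cP] := nP.
have ns : (succ x0 <= x0)%O = false by rewrite succ_le ltxx.
have sc : (succ x0 <= c)%O by rewrite succ_le.
have xs : (x0 < succ x0)%O := lt_succ hW x0.
pose e := r - inc P x0.
pose S x := if (x <= x0)%O then P x else P x + e.
pose P' := glue (succ x0) (glue x0 P S) (fun x => P x + e).
have Pl x : (x <= x0)%O -> P' x = P x.
  by move=> xx; rewrite /P' /glue xx (le_trans xx (ltW xs)).
have Pr x : (x0 < x)%O -> P' x = P x + e.
  by move=> xx; rewrite /P' /glue /S (leNgt x x0) xx /=; case: ifP.
have nP' : normal bot c P'.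
  apply: normal_glue => //; [exact: bot_le|by rewrite /glue /S ns| |].
    apply: normal_glue => //; [exact: bot_le|exact: ltW|by rewrite /S lexx| |].
      exact: normal_sub (lexx _) (ltW x0c) nP.
    by apply: normal_succ; rewrite /S lexx ns /e /inc; lra.
  exact: normal_sub (bot_le _ _) (lexx _) (normalD _ nP).
have i0 : inc P' x0 = r by rewrite {1}/inc (Pl x0) // (Pr _ xs) /e /inc; ring.
have ix x : x <> x0 -> inc P' x = inc P x.
  move=> xx; have [h|h|//] := ltgtP x x0; rewrite /inc.
    by rewrite !Pl ?succ_le // ltW.
  by rewrite (Pr _ h) (Pr _ (lt_trans h (lt_succ hW x))); ring.
have c0 := inc_gt0 nP x0c.
have [sG sH GK HK [mG G0 G1]] := stretchP c0.
have [sG' _ _ _ [_ G0' G1']] := stretchP r0.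
(* Undo the old stretch over [x0], then apply the one of the new length. *)
pose g t := P x0 + stretch r (unstretch (inc P x0) (t - P x0)).
exists P', g; split => //.
- by move=> x _; exact: ix.
- move=> k; apply: CkD; first exact: Ck_cst.
  apply: Ck_comp; first exact: sG'.
  apply: Ck_comp; first exact: sH.
  by apply: CkD; [exact: Ck_id|exact: Ck_cst].
- move=> p pc; have /andP[h1 h2] := phi_range nP pc.
  have [px|px|ep] := ltgtP p.1 x0.
  + have h : phi P p - P x0 <= 0.
      rewrite subr_le0; apply: (le_trans (ltW h2)).
      by apply: (normal_le nP) (ltW x0c); [exact: bot_le|rewrite succ_le].
    have -> : g (phi P p) = phi P p.
      by rewrite /g -{1}(G0 _ h) GK G0' //; ring.
    by rewrite /phi Pl ?(ltW px) // ix //; apply/eqP; rewrite lt_eqF.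
  + have h : inc P x0 <= phi P p - P x0.
      have : P (succ x0) <= P p.1 by apply: (normal_le nP);
        [exact: bot_le|rewrite succ_le|exact: ltW].
      by rewrite /inc; lra.
    have -> : g (phi P p) = phi P p + e.
      have h' : 1 <= phi P p - P x0 - (inc P x0 - 1) by lra.
      rewrite /g -[phi P p - P x0](_ : phi P p - P x0 - (inc P x0 - 1) + (inc P x0 - 1) = _);
        last by ring.
      by rewrite -G1 // GK G1' // /e; ring.
    rewrite /phi Pr // ix; first by ring.
    by apply/eqP; rewrite gt_eqF.
  + rewrite /g /phi ep Pl // i0; congr (_ + stretch r _).
    by rewrite -[RHS]GK; congr unstretch; ring.
Qed.

(** The finitely many discrepancies are removed one at a time by [transition1]; when none is left
    the two coordinates differ by a translation. *)
Lemma transition c P Q : normal bot c P -> normal bot c Q -> coh bot c P Q ->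
  exists g, smooth g /\ forall p, (p.1 < c)%O -> g (phi P p) = phi Q p.
Proof.
move=> nP nQ /finite_seqP[s es].
have h x : (x < c)%O -> inc P x <> inc Q x -> x \in s.
  move=> xc hx; suff : [set` s] x by [].
  by rewrite -es; split => //; exact: bot_le.
elim: s P nP {es} h => [|x0 s IH] P nP h.
  exists (fun t => t + (Q bot - P bot)); split.
    by move=> k; apply: CkD; [exact: Ck_id|exact: Ck_cst].
  have e x : (bot <= x)%O -> (x < c)%O -> inc P x = inc Q x.
    by move=> _ xc; apply: contrapT => /(h x xc).
  move=> p pc; rewrite /phi (inc_eq_const nP nQ e (bot_le _ _) (ltW pc)) e ?bot_le //; ring.
have [[x0c d0]|nd] := pselect ((x0 < c)%O /\ inc P x0 <> inc Q x0).
  have [P' [g [nP' i0 ix sg gP]]] := transition1 nP x0c (inc_gt0 nQ x0c).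
  have [x xc|g' [sg' gP']] := IH P' nP'.
    have [->|/eqP xx] := eqVneq x x0; first by rewrite i0.
    by rewrite ix // => /(h x xc); rewrite inE => /orP[/eqP|].
  exists (fun t => g' (g t)); split.
    by move=> k; apply: Ck_comp; [exact: sg'|exact: sg].
  by move=> p pc; rewrite gP // gP'.
(* Here [x0] is no discrepancy below [c] and is dropped from the list. *)
apply: IH => // x xc xd; have := h x xc xd; rewrite inE => /orP[/eqP ex|//].
by exfalso; apply: nd; rewrite -ex.
Qed.

End Coordinate.

(** * Functions of one real variable as maps of row vectors of length one *)

Section Lift.
Local Open Scope ring_scope.
Context {R : realType}.

Definition lift1 (g : R -> R) (v : 'rV[R]_1) : 'rV[R]_1 := const_mx (g (v 0 0)).

Lemma const_mx_continuous n : continuous (fun r : R => const_mx r : 'rV[R]_n).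
Proof.
move=> r A [P /= nP sP].
have h : \forall s \near r, forall j : 'I_n, P 0 j s.
  by apply: (@filter_forall _ _ (fun j => P 0 j) (nbhs r)) => j; have := nP 0 j; rewrite mxE.
by apply: filterS h => s h; apply: sP => /= i j; rewrite mxE (ord1 i).
Qed.

Lemma lift1_continuous g : continuous g -> continuous (lift1 g).
Proof.
move=> cg v; apply: (@continuous_comp _ _ _ (fun v : 'rV[R]_1 => v 0 0) (fun t => const_mx (g t))).
  exact: coord_continuous.
by apply: (@continuous_comp _ _ _ g (fun r : R => const_mx r));
  [exact: cg|exact: const_mx_continuous].
Qed.

Lemma lift1_derive g (v : 'rV[R]_1) (i : 'I_1) :
  (forall x : R, derivable g x 1) ->
  derivable (lift1 g) v (evec R i) /\ 'D_(evec R i) (lift1 g) v = lift1 (derive1 g) v.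
Proof.
move=> dg; set l := lift1 (derive1 g) v.
suff cl : (fun h : R => h^-1 *: ((lift1 g \o shift v) (h *: evec R i) - lift1 g v)) @ 0^' --> l.
  split; last exact/cvg_lim.
  by apply/cvg_ex; exists l.
have dgv : (fun h : R => h^-1 *: ((g \o shift (v 0 0)) (h *: (1 : R)) - g (v 0 0))) @ 0^' -->
  derive1 g (v 0 0).
  rewrite derive1E; exact: dg.
have := cvg_comp _ _ dgv (@const_mx_continuous 1 (derive1 g (v 0 0))).
apply: cvg_trans; apply: near_eq_cvg; near=> h => /=.
by apply/rowP => j; rewrite !mxE /= (ord1 i) eqxx.
Unshelve. all: by end_near. Qed.

Lemma lift1_Ck g k U : smooth g -> Ck_on k U (lift1 g).
Proof.
elim: k g U => [|k IH] g U sg /=.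
  by apply: continuous_subspaceT; apply: lift1_continuous; exact: (sg 0%N).
have [dg _] := sg 1%N; split.
- by apply: continuous_subspaceT; apply: lift1_continuous; exact: (sg 0%N).
- by move=> i x _; have [] := lift1_derive x i dg.
- move=> i; have -> : 'D_(evec R i) (lift1 g) = lift1 (derive1 g).
    by apply/funext => v; have [] := lift1_derive v i dg.
  by apply: IH => m; have [] := sg m.+1.
Qed.

Lemma lift1_C r g U : smooth g -> C_on r U (lift1 g).
Proof. by move=> sg; case: r => [k|k]; exact: lift1_Ck. Qed.

End Lift.

(** * The charts and the atlas of a coherent family *)

Section Charts.
Local Open Scope ring_scope.
Context (R : realType) (d : Order.disp_t) (W : orderType d) (hW : is_omega1 W).
Implicit Types (a b c : W) (P Q S : W -> R) (p q : Lge0 R W) (x y : Lplus R W).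

Local Notation bot := (bot hW).
Local Notation normal := (normal hW).
Local Notation coh := (coh hW).
Local Notation phi := (phi hW).

Definition base c : Lge0 R W :=
  (c, exist (fun r : R => (0 <= r) && (r < 1)) 0 (introT andP (conj (lexx 0) ltr01)) : unit_itv R).

Lemma lt_base p c : (p < base c)%O = (p.1 < c)%O.
Proof.
rewrite ltLge0 /=; case: (ltgtP p.1 c) => //= _.
by apply/negbTE; rewrite -leNgt; have /andP[] := valP p.2.
Qed.

(** Take the midpoint between the second coordinate and 1. Staying over the same ordinal keeps the
    new point in every chart domain that contains [p]. *)
Lemma Lge0_above p : exists q : Lge0 R W, (p < q)%O /\ q.1 = p.1.
Proof.
have /andP[] : 0 <= val p.2 < 1 by exact: (valP p.2).
set t := val p.2 => h0 h1.
have h : (0 <= (t + 1) / 2) && ((t + 1) / 2 < 1) by apply/andP; split; lra.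
exists (p.1, exist (fun r : R => (0 <= r) && (r < 1)) _ h : unit_itv R); split => //.
by rewrite ltLge0 eqxx /= -/t; apply/orP; right; lra.
Qed.

Lemma Lplus_below x : exists q : Lge0 R W, (q < sval x)%O.
Proof. by have /asboolP := svalP x. Qed.

Lemma Lplus_inj x y : sval x = sval y -> x = y.
Proof.
case: x y => [x hx] [y hy] /= e; subst y; congr exist; exact: bool_irrelevance.
Qed.

Definition in_Lplus q p (h : (q < p)%O) : Lplus R W :=
  exist _ p (introT (asboolP _) (ex_intro _ q h)).

Lemma open_Lplus_itv p q : open [set x : Lplus R W | (p < sval x)%O && (sval x < q)%O].
Proof.
exists [set` `]p, q[%O]; first exact: itv_open.
by apply/seteqP; split => x /=; rewrite in_itv.
Qed.

Lemma open_Lplus_ray q : open [set x : Lplus R W | (sval x < q)%O].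
Proof.
exists [set` `]-oo, q[%O]; first exact: lray_open.
by apply/seteqP; split => x /=; rewrite in_itv.
Qed.

(** Unbounded basic intervals of the order topology can be cut off, since a point of the long ray
    has points of the closed long ray both below and above it. *)
Lemma nbhs_Lplus x (A : set (Lplus R W)) : nbhs x A -> exists p q : Lge0 R W,
  [/\ (p < sval x)%O, (sval x < q)%O &
    forall y : Lplus R W, (p < sval y)%O -> (sval y < q)%O -> A y].
Proof.
rewrite nbhsE => -[V [[B oB <-] Bx] sO].
have /= := open_nbhs_nbhs (conj oB Bx); rewrite itv_nbhsE => -[i [oi xi] iB].
have [p0 p0x] := Lplus_below x; have [q0 [xq0 _]] := Lge0_above (sval x).
case: i oi xi iB => [[[|] l|[|]] [[|] u|[|]]] //= _ xi iB.
- move: xi; rewrite in_itv => /andP[lx xu]; exists l, u; split => // y ly yu.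
  by apply: sO; apply: iB; rewrite /= in_itv /= ?ly ?yu.
- move: xi; rewrite in_itv andbT => lx; exists l, q0; split => // y ly yu.
  by apply: sO; apply: iB; rewrite /= in_itv /= ?ly ?yu.
- move: xi; rewrite in_itv => xu; exists p0, u; split => // y ly yu.
  by apply: sO; apply: iB; rewrite /= in_itv /= ?ly ?yu.
- by exists p0, q0; split => // y ly yu; apply: sO; apply: iB.
Qed.

Lemma Lplus_nbhs x (A : set (Lplus R W)) p q : (p < sval x)%O -> (sval x < q)%O ->
  (forall y : Lplus R W, (p < sval y)%O -> (sval y < q)%O -> A y) -> nbhs x A.
Proof.
move=> px xq sA; rewrite nbhsE.
exists [set x : Lplus R W | (p < sval x)%O && (sval x < q)%O].
  by split; [exact: open_Lplus_itv|rewrite /= px].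
by move=> y /= /andP[]; exact: sA.
Qed.

Definition phi_chart c P : chart R (Lplus R W) 1 :=
  Chart [set x : Lplus R W | ((sval x).1 < c)%O] (fun x => const_mx (phi P (sval x))).

Lemma open_dom c P : open (cdom (phi_chart c P)).
Proof.
have -> : cdom (phi_chart c P) = [set x : Lplus R W | (sval x < base c)%O].
  by apply/seteqP; split => x /=; rewrite lt_base.
exact: open_Lplus_ray.
Qed.

(** Values within [e / 2] of the coordinate of [x] are pulled back by [phi_surj]. The order bounds
    serve the openness of images, the metric bounds the continuity of the coordinate. *)
Lemma phi_between c P p q x (e : R) : normal bot c P -> 0 < e ->
  (p < sval x)%O -> (sval x < q)%O -> ((sval x).1 < c)%O ->
  exists p' q' : Lge0 R W, [/\ (p <= p')%O, (q' <= q)%O, (p' < sval x)%O, (sval x < q')%O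
    & [/\ (q'.1 < c)%O, phi P (sval x) - e < phi P p' & phi P q' < phi P (sval x) + e]].
Proof.
move=> nP e0; move: (sval x) => {x} x px xq xc.
have pc : (p.1 < c)%O by apply: le_lt_trans xc; move: px;
  rewrite ltLge0 => /orP[/ltW|/andP[/eqP -> _]].
have [q0 [xq0 eq0]] := Lge0_above x.
(* The point [q] may lie outside the chart; [q0] is over the same ordinal as [x]. *)
pose q1 := Order.min q q0.
have xq1 : (x < q1)%O by rewrite lt_min xq xq0.
have q1c : (q1.1 < c)%O.
  have : (q1 <= q0)%O by rewrite ge_min lexx orbT.
  rewrite le_eqVlt => /orP[/eqP ->|]; first by rewrite eq0.
  by rewrite ltLge0 eq0 => /orP[/lt_trans|/andP[/eqP -> _]] //; apply.
have h1 := phi_lt nP xc px; have h2 := phi_lt nP q1c xq1.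
pose v1 := Order.max (phi P p) (phi P x - e / 2).
pose v2 := Order.min (phi P q1) (phi P x + e / 2).
have e2 : 0 < e / 2 by rewrite divr_gt0.
have v1x : v1 < phi P x by rewrite gt_max h1; lra.
have v2x : phi P x < v2 by rewrite lt_min h2; lra.
have [||w1 [w1c ew1]] := @phi_surj _ _ _ hW c P p x v1 nP pc xc;
  [by rewrite le_max lexx|exact: ltW|].
have [||w2 [w2c ew2]] := @phi_surj _ _ _ hW c P x q1 v2 nP xc q1c;
  [exact: ltW|by rewrite ge_min lexx|].
exists w1, w2; rewrite -(phi_lt_mono nP w1c xc) -(phi_lt_mono nP xc w2c) ew1 ew2 v1x v2x.
split => //.
- rewrite leNgt -(phi_lt_mono nP w1c pc) ew1 -leNgt le_max lexx //.
- apply: (@le_trans _ _ q1); last by rewrite ge_min lexx.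
  by rewrite leNgt -(phi_lt_mono nP q1c w2c) ew2 -leNgt ge_min lexx.
- split => //; first by rewrite lt_max; apply/orP; right; lra.
  by rewrite gt_min; apply/orP; right; lra.
Qed.

Lemma phi_continuous c P x : normal bot c P -> ((sval x).1 < c)%O ->
  (fun x : Lplus R W => phi P (sval x)) @ x --> phi P (sval x).
Proof.
move=> nP xc A /nbhs_ballP[e /= e0 eA].
have [p px] := Lplus_below x; have [q [xq _]] := Lge0_above (sval x).
have [p' [q' [_ _ px' xq' [q'c h1 h2]]]] := phi_between nP e0 px xq xc.
apply: (Lplus_nbhs px' xq') => y py yq; apply: eA; rewrite /ball /=.
have yc : ((sval y).1 < c)%O.
  by move: yq; rewrite ltLge0 => /orP[/lt_trans|/andP[/eqP -> _]] //; apply.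
have k1 := phi_lt nP yc py; have k2 := phi_lt nP q'c yq.
by rewrite ltr_norml; apply/andP; split; lra.
Qed.

Lemma phi_is_chart c P : normal bot c P -> is_chart (phi_chart c P).
Proof.
move=> nP; split; first exact: open_dom.
- move=> x y /[!inE] /= xc yc /rowP/(_ 0); rewrite !mxE => /(phi_inj nP xc yc).
  exact: Lplus_inj.
- apply: continuous_in_subspaceT => x /[!inE] /= xc.
  apply: (@continuous_comp _ _ _ (fun x : Lplus R W => phi P (sval x)) (fun r
    : R => const_mx r)); last exact: const_mx_continuous.
  exact: (phi_continuous nP xc).
- move=> O oO Oc; rewrite openE => v [x Ox <-].
  have xc : ((sval x).1 < c)%O by exact: Oc.
  have [p [q [px xq pqO]]] := nbhs_Lplus (open_nbhs_nbhs (conj oO Ox)).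
  have [p' [q' [pp' qq' px' xq' [q'c _ _]]]] := phi_between nP (@ltr01 R) px xq xc.
  have p'c : (p'.1 < c)%O.
    by move: px'; rewrite ltLge0 => /orP[/lt_trans|/andP[/eqP -> _]] //; apply.
  (* A neighbourhood of a row vector is given entry by entry; here the single entry ranges over an
     open interval, all of whose values are attained by [phi_surj]. *)
  exists (fun _ _ => [set` `]phi P p', phi P q'[]) => /=.
    move=> i j; rewrite mxE; apply: open_nbhs_nbhs; split; first exact: itv_open.
    by rewrite /= in_itv /= (phi_lt nP xc px') (phi_lt nP q'c xq').
  move=> w /(_ 0 0) /=; rewrite in_itv /= => /andP[k1 k2].
  have [y [yc ey]] := phi_surj nP p'c q'c (ltW k1) (ltW k2).
  have py' : (p' < y)%O by rewrite -(phi_lt_mono nP p'c yc) ey.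
  have yq' : (y < q')%O by rewrite -(phi_lt_mono nP yc q'c) ey.
  exists (in_Lplus py').
    by apply: pqO; [exact: le_lt_trans py'|exact: lt_le_trans qq'].
  by apply/rowP => j; rewrite !mxE /= ey (ord1 j).
Qed.

(** The chart domains overlap exactly below the smaller index, where coherence provides a single
    smooth function on all of R. *)
Lemma phi_compatible r a b P Q : normal bot a P -> normal bot b Q ->
  coh bot (Order.min a b) P Q -> compatible r (phi_chart a P) (phi_chart b Q).
Proof.
move=> nP nQ cPQ; pose c := Order.min a b.
have [||g [sg gE]] := @transition _ _ _ hW c P Q _ _ cPQ.
- by apply: normal_sub nP => //; rewrite ge_min lexx.
- by apply: normal_sub nQ => //; rewrite ge_min lexx orbT.
exists (lift1 g); split; first exact: lift1_C.
move=> x /= xa xb; apply/rowP => j; rewrite !mxE gE //.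
by rewrite lt_min xa.
Qed.

Definition phi_atlas (F : W -> W -> R) : set (chart R (Lplus R W) 1) :=
  [set h | exists c, h = phi_chart c (F c)].

Lemma phi_atlasP r (F : W -> W -> R) : (forall a, normal bot a (F a)) ->
  (forall a b, (b < a)%O -> coh bot b (F b) (F a)) -> atlas r (phi_atlas F).
Proof.
move=> nF cF; split.
- by move=> _ [c ->]; exact: phi_is_chart.
- move=> x; exists (phi_chart (succ hW (sval x).1) (F (succ hW (sval x).1))).
    by eexists.
  exact: lt_succ.
- move=> _ _ [a ->] [b ->]; apply: phi_compatible => //.
  case: (ltgtP a b) => [ab|ba|->]; [exact: cF|apply: coh_sym; exact: cF|].
  exact: coh_eq.
Qed.

End Charts.

(** * Real codes and rates *)

Section Code.
Local Open Scope ring_scope.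
Context {R : realType}.
Implicit Types A B : set nat.

(** Base 3 with digits 0 and 1: unlike in base 2, no two digit sequences have the same value. *)
Definition digits A (n : nat) : R := \sum_(i < n) (`[< A i >]%:R / 3 ^+ i).
Definition code A : R := sup (range (digits A)).

Lemma digitsS A n : digits A n.+1 = digits A n + `[< A n >]%:R / 3 ^+ n.
Proof. by rewrite /digits big_ord_recr. Qed.

(** The quantity [(3 / 2) / 3 ^+ i] is the sum of the geometric series of ratio 1/3 from index [i]
    on. *)
Lemma digits_le A i n : digits A (i + n) <= digits A i + (3 / 2) / 3 ^+ i - (3 / 2) / 3 ^+ (i + n).
Proof.
elim: n => [|n IH]; first by rewrite addn0 addrK.
rewrite addnS digitsS exprS.
have e0 : 0 < 3 ^+ (i + n) :> R by rewrite exprn_gt0.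
have : `[< A (i + n)%N >]%:R / 3 ^+ (i + n) <= 1 / 3 ^+ (i + n) :> R.
  by rewrite ler_pM2r ?invr_gt0 //; case: asboolP.
have -> : (3 / 2) / (3 * 3 ^+ (i + n)) = 3 / 2 / 3 ^+ (i + n) - 1 / 3 ^+ (i + n) :> R.
  by field; rewrite gt_eqF.
lra.
Qed.

Lemma digits_mono A m n : (m <= n)%N -> digits A m <= digits A n.
Proof.
elim: n => [|n IH]; first by rewrite leqn0 => /eqP ->.
rewrite leq_eqVlt => /orP[/eqP ->//|/IH h]; apply: (le_trans h).
by rewrite digitsS lerDl divr_ge0 // exprn_ge0.
Qed.

Lemma digits_bounded A i n : digits A n <= digits A i + (3 / 2) / 3 ^+ i.
Proof.
apply: (@le_trans _ _ (digits A (i + n))); first by rewrite digits_mono // leq_addl.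
apply: (le_trans (digits_le A i n)); rewrite lerBlDr lerDl.
by rewrite !divr_ge0 // exprn_ge0.
Qed.

Lemma digits_le_code A n : digits A n <= code A.
Proof.
apply: ub_le_sup; last by exists n.
exists (digits A 0 + (3 / 2) / 3 ^+ 0) => _ [m _ <-]; exact: digits_bounded.
Qed.

Lemma code_le A (r : R) : (forall n, digits A n <= r) -> code A <= r.
Proof.
move=> h; apply: sup_le_ub; first by exists (digits A 0), 0%N.
by move=> _ [m _ <-].
Qed.

Lemma code_ge0 A : 0 <= code A.
Proof. by have := digits_le_code A 0; rewrite /digits big_ord0. Qed.

(** At the first difference [A] gains [1 / 3 ^+ i], while all later digits of [B] contribute at most
    half of that. *)
Lemma code_lt A B i : (forall j, (j < i)%N -> A j <-> B j) -> A i -> ~ B i ->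
  code B < code A.
Proof.
move=> e Ai nBi.
have ed : digits A i = digits B i.
  by apply: eq_bigr => j _; congr ((nat_of_bool _)%:R / _); apply: asbool_equiv_eq; exact: e.
have hA : digits B i + 1 / 3 ^+ i <= code A.
  have := digits_le_code A i.+1; rewrite digitsS ed.
  by case: asboolP => // _; rewrite mulr1n.
have hB : code B <= digits B i + (1 / 2) / 3 ^+ i.
  apply: code_le => n; have := digits_bounded B i.+1 n; rewrite digitsS.
  case: asboolP => // _; rewrite mul0r addr0 exprS => h; apply: (le_trans h).
  have -> : 3 / 2 / (3 * 3 ^+ i) = (1 / 2) / 3 ^+ i :> R; last by [].
  by field; rewrite gt_eqF // exprn_gt0.
apply: (le_lt_trans hB); apply: (lt_le_trans _ hA); rewrite ltrD2l.
by rewrite ltr_pM2r ?invr_gt0 ?exprn_gt0 //; lra.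
Qed.

Lemma code_inj : injective code.
Proof.
move=> A B e; apply: contrapT => nAB.
have ex : exists i, ~~ `[< A i <-> B i >].
  apply: contrapT => nex; apply: nAB; apply/seteqP.
  suff h i : A i <-> B i by split => i /h.
  by apply: contrapT => /asboolPn ni; apply: nex; exists i.
case: (ex_minnP ex) => i /asboolPn ni mini.
have lei j : (j < i)%N -> A j <-> B j.
  by move=> ji; apply: contrapT => /asboolPn /mini; rewrite leqNgt ji.
have [Ai|nAi] := pselect (A i).
  have nBi : ~ B i by move=> Bi; apply: ni.
  by have := code_lt lei Ai nBi; rewrite e ltxx.
have Bi : B i by apply: contrapT => nBi; apply: ni.
have lei' j : (j < i)%N -> B j <-> A j by move=> /lei[].
by have := code_lt lei' Bi nAi; rewrite e ltxx.
Qed.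

(* The exponent is quadratic in [n], so that the shift from [m] to [m.+1] in [rate_gap]
   costs less than any change of [x]. *)
Definition rate (x : R) (n : nat) : R := expR (- (x * n%:R ^+ 2)).

Lemma rate_gt0 x n : 0 < rate x n. Proof. exact: expR_gt0. Qed.

Lemma rate_lt x n : 0 < x -> rate x n.+1 < rate x n.
Proof.
move=> x0; rewrite ltr_expR ltrN2 ltr_pM2l // ltrXn2r ?nnegrE ?ler0n //.
by rewrite ltr_nat.
Qed.

Lemma rate_small x e : 0 < x -> 0 < e -> exists n, rate x n < e.
Proof.
move=> x0 e0; pose n := (Num.truncn (e^-1 / x)).+1; have hn : e^-1 / x < n%:R := truncnS_gt _;
  exists n.+1.
rewrite /rate expRN invf_plt ?posrE ?expR_gt0 //.
apply: (lt_le_trans _ (expR_ge1Dx _)); rewrite ltr_pdivrMr // in hn.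
have h1 : 0 <= x * n%:R by rewrite mulr_ge0 // ltW.
have h2 : 0 <= x * n%:R ^+ 2 by rewrite mulr_ge0 ?exprn_ge0 // ltW.
by rewrite -natr1 sqrrD; lra.
Qed.

(** The quotient of the rates has exponent [(x - y) * m ^ 2 - 2 * y * m - y]. Once [(x - y) * m]
    exceeds [|K| + 3 * y] and [m >= 1], this is at least [|K|], and the exponential is larger than
    its argument. *)
Lemma rate_gap x y K : 0 < y -> y < x -> exists M, forall m, (M <= m)%N ->
  K * rate x m < rate y m.+1.
Proof.
move=> y0 yx; have d0 : 0 < x - y by rewrite subr_gt0.
pose M := (Num.truncn ((`|K| + 3 * y) / (x - y))).+1.
have hM : (`|K| + 3 * y) / (x - y) < M%:R := truncnS_gt _.
exists M.+1 => m Mm.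
have m1 : 1 <= m%:R :> R by rewrite ler1n; apply: leq_trans Mm.
have hm : `|K| + 3 * y <= (x - y) * m%:R.
  rewrite -ler_pdivrMl // mulrC; apply: (le_trans (ltW hM)).
  by rewrite ler_nat ltnW.
apply: (@le_lt_trans _ _ (`|K| * rate x m)).
  by rewrite ler_pM2r ?rate_gt0 // ler_norm.
rewrite /rate -ltr_pdivlMr ?expR_gt0 // -expRN -expRD opprK.
apply: (lt_le_trans _ (expR_ge1Dx _)).
have K0 : 0 <= `|K| by [].
have h : 0 <= (m%:R - 1) * ((x - y) * m%:R - 3 * y - `|K|) by rewrite mulr_ge0 //; lra.
have h2 : 0 <= (m%:R - 1) * `|K| by rewrite mulr_ge0 //; lra.
have h3 : 0 <= (m%:R - 1) * y by rewrite mulr_ge0 //; lra.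
rewrite -natr1; move: h h2 h3 hm; move: (m%:R : R) => t; nra.
Qed.

End Code.

(** * Lipschitz estimates for C^1 maps *)

Section Lipschitz.
Local Open Scope ring_scope.
Context {R : realType}.

(** Written in the block form of the values of [prod_chart]. *)
Definition vec (s t : R) : 'rV[R]_(1 + 1) := row_mx (const_mx s) (const_mx t).

Lemma vec_left s t h : vec (s + h) t = vec s t + h *: evec R (lshift 1 (0 : 'I_1)).
Proof.
apply/rowP => j; rewrite !mxE; case: splitP => k jk; rewrite !mxE.
  have -> : j = lshift 1 0 by apply/val_inj; rewrite /= jk (ord1 k).
  by rewrite !eqxx mulr1.
have -> : (j == lshift 1 0) = false by apply/negbTE/eqP => e; move: jk; rewrite e.
by rewrite andbF mulr0 addr0.
Qed.

Lemma vec_right s t h : vec s (t + h) = vec s t + h *: evec R (rshift 1 (0 : 'I_1)).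
Proof.
apply/rowP => j; rewrite !mxE; case: splitP => k jk; rewrite !mxE; last first.
  have -> : j = rshift 1 0 by apply/val_inj; rewrite /= jk (ord1 k).
  by rewrite !eqxx mulr1.
have -> : (j == rshift 1 0) = false by apply/negbTE/eqP => e; move: jk; rewrite e (ord1 k).
by rewrite andbF mulr0 addr0.
Qed.

Context (n m : nat).
Implicit Types (g : 'rV[R]_n -> 'rV[R]_m) (w : 'rV[R]_n).

Lemma is_derive_line g w v (k : 'I_m) (r : R) : derivable g (w + r *: v) v ->
  is_derive r (1 : R) (fun r => g (w + r *: v) 0 k) ('D_v g (w + r *: v) 0 k).
Proof.
move=> dg.
suff cl : (fun h : R => h^-1 *: (((fun r => g (w + r *: v) 0 k) \o shift r) (h *: (1 : R)) -
    g (w + r *: v) 0 k)) @ 0^' --> 'D_v g (w + r *: v) 0 k.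
  by apply: DeriveDef; [apply/cvg_ex; eexists; exact: cl|exact/cvg_lim].
have dgv : (fun h : R => h^-1 *: ((g \o shift (w + r *: v)) (h *: v) - g (w + r *: v))) @ 0^'
  --> 'D_v g (w + r *: v) by exact: dg.
have := cvg_comp _ _ dgv (@coord_continuous _ _ _ 0 k ('D_v g (w + r *: v))).
apply: cvg_trans; apply: near_eq_cvg; near=> h => /=.
rewrite !mxE [h *: 1]mulr1 scalerDl; congr (_ * (g _ _ _ - _)).
by rewrite addrCA.
Unshelve. all: by end_near. Qed.

(** The mean value theorem is applied to one coordinate of [g], because it fails for vector-valued
    maps. *)
Lemma lipschitz_line g w v (k : 'I_m) (h K : R) : 0 <= h ->
  (forall r, 0 <= r <= h -> derivable g (w + r *: v) v) ->
  (forall r, 0 <= r <= h -> `|'D_v g (w + r *: v) 0 k| <= K) ->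
  `|g (w + h *: v) 0 k - g w 0 k| <= K * h.
Proof.
move=> h0 dg bg; pose f r := g (w + r *: v) 0 k.
have d r : 0 <= r <= h -> is_derive r (1 : R) f ('D_v g (w + r *: v) 0 k).
  by move=> rh; apply: is_derive_line; exact: dg.
have [c ch e] : exists2 c, c \in `[0, h] & f h - f 0 = 'D_v g (w + c *: v) 0 k * (h - 0).
  apply: (@MVT_segment _ f (fun c => 'D_v g (w + c *: v) 0 k)) => //.
    by move=> r /[!in_itv] /= /andP[r0 rh]; apply: d; rewrite !ltW.
  apply: derivable_within_continuous => r /[!in_itv] /= /d rh.
  by case: rh.
move: e; rewrite /f scale0r addr0 subr0 => ->.
rewrite normrM (ger0_norm h0) ler_wpM2r //; apply: bg.
by move: ch; rewrite in_itv.
Qed.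

Lemma coord_le_norm (v : 'rV[R]_m) k : `|v 0 k| <= `|v|.
Proof.
rewrite [leRHS]/Num.norm /= mx_normrE.
exact: (le_bigmax _ (fun ij : 'I_1 * 'I_m => `|v ij.1 ij.2|) (0, k)).
Qed.

Lemma within_bounded (U : set 'rV[R]_n) g w : {within U, continuous g} -> U w ->
  exists e : R, 0 < e /\ forall w', U w' -> ball w e w' ->
    forall k, `|g w' 0 k| <= `|g w| + 1.
Proof.
move=> /subspace_continuousP cg Uw; have /cvgrPdist_lt/(_ _ ltr01) := cg w Uw.
rewrite near_withinE => /nbhs_ballP[e e0 he]; exists e; split => // w' Uw' bw' k.
have := he w' bw' Uw' => h.
apply: (le_trans (coord_le_norm _ _)).
have -> : g w' = g w - (g w - g w') by rewrite opprB addrC subrK.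
by apply: (le_trans (ler_normB _ _)); rewrite lerD2l ltW.
Qed.

End Lipschitz.

Section LipschitzC1.
Local Open Scope ring_scope.

(** The path from [(s, s)] through [(s0, s)] to [(s0, s0)] follows the axes and stays in the lower
    left square, where both partial derivatives are bounded near the corner by continuity. *)
Lemma C1_lipschitz (R : realType) (m : nat) (U : set 'rV[R]_(1 + 1))
    (g : 'rV[R]_(1 + 1) -> 'rV[R]_m) (s0 dl : R) : Ck_on 1 U g -> 0 < dl ->
  (forall s t, s0 - dl <= s <= s0 -> s0 - dl <= t <= s0 -> U (vec s t)) ->
  exists K e, 0 < e /\ forall s, s0 - e <= s <= s0 ->
    forall k, `|g (vec s0 s0) 0 k - g (vec s s) 0 k| <= K * (s0 - s).
Proof.
move=> [_ dg cg] dl0 hU.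
have U0 : U (vec s0 s0) by apply: hU; apply/andP; split; lra.
have [e1 [e10 b1]] := within_bounded (cg (lshift 1 0)) U0.
have [e2 [e20 b2]] := within_bounded (cg (rshift 1 0)) U0.
pose K1 := `|'D_(evec R (lshift 1 0)) g (vec s0 s0)| + 1.
pose K2 := `|'D_(evec R (rshift 1 0)) g (vec s0 s0)| + 1.
pose e := Num.min dl (Num.min (e1 / 2) (e2 / 2)).
have e0 : 0 < e by rewrite !lt_min dl0 !divr_gt0.
have edl : e <= dl by rewrite ge_min lexx.
have ee1 : e < e1 by rewrite !gt_min; apply/orP; right; apply/orP; left; lra.
have ee2 : e < e2 by rewrite !gt_min; apply/orP; right; apply/orP; right; lra.
have bb (e' : R) s t : e < e' -> s0 - e <= s <= s0 -> s0 - e <= t <= s0 ->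
    ball (vec s0 s0) e' (vec s t).
  move=> ee3 /andP[h1 h2] /andP[h3 h4]; split; first exact: lt_trans ee3.
  move=> i j; rewrite !mxE; case: splitP => k _; rewrite !mxE /ball /=.
    by rewrite ger0_norm; lra.
  by rewrite ger0_norm; lra.
have UU s t : s0 - e <= s <= s0 -> s0 - e <= t <= s0 -> U (vec s t).
  by move=> h1 h2; apply: hU; apply/andP; split; lra.
exists (K1 + K2), e; split => // s hs k.
have h0 : 0 <= s0 - s by lra.
have es : s0 = s + (s0 - s) by ring.
have s00 : s0 - e <= s0 <= s0 by rewrite lexx andbT; lra.
have hr r : 0 <= r <= s0 - s -> s0 - e <= s + r <= s0 by lra.
have l1 : `|g (vec s0 s) 0 k - g (vec s s) 0 k| <= K1 * (s0 - s).
  rewrite {1}es vec_left; apply: lipschitz_line => // r /hr h; rewrite -vec_left.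
    by apply: dg; exact: UU.
  by apply: b1; [exact: UU|exact: bb].
have l2 : `|g (vec s0 s0) 0 k - g (vec s0 s) 0 k| <= K2 * (s0 - s).
  rewrite {2}es vec_right; apply: lipschitz_line => // r /hr h; rewrite -vec_right.
    by apply: dg; exact: UU.
  by apply: b2; [exact: UU|exact: bb].
apply: (le_trans (ler_distD (g (vec s0 s) 0 k) _ _)).
have -> : (K1 + K2) * (s0 - s) = K2 * (s0 - s) + K1 * (s0 - s) by ring.
exact: (lerD l2 l1).
Qed.

End LipschitzC1.

(** * The corner of a preserved square *)

Section Square.
Local Open Scope ring_scope.
Context (R : realType) (d : Order.disp_t) (W : orderType d) (hW : is_omega1 W).
Implicit Types (a b c : W) (P Q S : W -> R) (p q : Lge0 R W) (x y : Lplus R W).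

Local Notation bot := (bot hW).
Local Notation succ := (succ hW).
Local Notation limit := (limit hW).
Local Notation normal := (normal hW).
Local Notation coh := (coh hW).
Local Notation phi := (phi hW).
Local Notation base := (base R).
Local Notation L2 := (Lplus R W * Lplus R W)%type.

(** A countable dense subset of the initial segment below [a]. *)
Definition rational_points a : set (Lplus R W) :=
  [set x | ((sval x).1 < a)%O /\ exists q : rat, val (sval x).2 = ratr q].

Lemma countable_rational_points a : countable (rational_points a).
Proof.
have [_ _ /(_ a)/countable_injP[f finj]] := hW.
have /choice[q qP] : forall x : Lplus R W, exists q : rat,
    (exists q : rat, val (sval x).2 = ratr q) -> val (sval x).2 = ratr q.
  move=> x; have [[q hq]|nq] := pselect (exists q : rat, val (sval x).2 = ratr q).
    by exists q.
  by exists 0.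
apply/countable_injP; exists (fun x => pickle (f (sval x).1, q x)) => x y.
rewrite !inE /= => -[xa /qP qx] [ya /qP qy] /(pcan_inj pickleK)[/finj e1 e2].
apply: Lplus_inj.
have {}e1 : (sval x).1 = (sval y).1 by apply: e1; rewrite inE.
have {}e2 : (sval x).2 = (sval y).2 by apply: val_inj; rewrite qx qy e2.
by move: e1 e2; case: (sval x) => ? ?; case: (sval y) => ? ? /= -> ->.
Qed.

Lemma dense_rational_points a x (A : set (Lplus R W)) : ((sval x).1 < a)%O ->
  nbhs x A -> exists y, rational_points a y /\ A y.
Proof.
move=> xa /nbhs_Lplus[p [q [px xq hA]]].
have /andP[t0 t1] : 0 <= val (sval x).2 < 1 by exact: (valP (sval x).2).
(* Over the ordinal of [x], all second coordinates below [u] stay below [q]; a rational is then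
   chosen between that of [x] and [u]. *)
have [u [tu u1 hu]] : exists u : R, [/\ val (sval x).2 < u, u <= 1 &
    forall y : Lge0 R W, y.1 = (sval x).1 -> val y.2 < u -> (y < q)%O].
  move: xq; rewrite ltLge0 => /orP[h|/andP[/eqP e h]].
    by exists 1; split => // y ey _; rewrite ltLge0 ey h.
  exists (val q.2); split => //.
    by have /andP[_ /ltW] : 0 <= val q.2 < 1 by exact: (valP q.2).
  by move=> y ey yq; rewrite ltLge0 ey e eqxx yq orbT.
have [r] := rat_in_itvoo tu; rewrite in_itv /= => /andP[tr ru].
have hr : (0 <= (ratr r : R)) && ((ratr r : R) < 1).
  by rewrite (le_trans t0 (ltW tr)) (lt_le_trans ru).
pose w : Lge0 R W := ((sval x).1, exist (fun r : R => (0 <= r) && (r < 1)) _ hr : unit_itv R).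
have xw : (sval x < w)%O by rewrite ltLge0 /= eqxx tr orbT.
exists (in_Lplus xw); split; first by split => //; exists r.
apply: hA; first exact: lt_trans xw.
exact: hu.
Qed.

Lemma nbhs_pair (z : L2) (A : set L2) : nbhs z A -> exists B C,
  [/\ nbhs z.1 B, nbhs z.2 C & forall x y, B x -> C y -> A (x, y)].
Proof.
move=> [[B C] /= [nB nC] BC]; exists B, C; split => // x y Bx Cy.
by apply: BC.
Qed.

Lemma open_above q : open [set x : Lplus R W | (q < sval x)%O].
Proof.
exists [set` `]q, +oo[%O]; first exact: rray_open.
by apply/seteqP; split => x /=; rewrite in_itv /= andbT.
Qed.

Definition box a : set L2 := [set z | ((sval z.1).1 < a)%O /\ ((sval z.2).1 < a)%O].

(** The images of a countable dense set are bounded by some [b]. By continuity no point of the box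
    can be sent above [base b], so [succ b] bounds the whole image. *)
Lemma bounded_image (h : L2 -> Lplus R W) a : continuous h ->
  exists b, forall z, box a z -> ((sval (h z)).1 < b)%O.
Proof.
move=> ch.
have cD := countable_rational_points a.
have [b hb] : exists b, forall w,
    [set (sval (h z)).1 | z in rational_points a `*` rational_points a] w -> (w < b)%O.
  apply: (countable_bounded hW).
  exact: sub_countable (card_image_le _ _) (countableX cD cD).
exists (succ b) => -[x y] [/= xa ya]; rewrite lt_succE leNgt; apply/negP => bh.
have : nbhs (h (x, y)) [set w : Lplus R W | (base b < sval w)%O].
  apply: open_nbhs_nbhs; split; first exact: open_above.
  by rewrite /= ltLge0 bh.
move=> /ch /nbhs_pair[B [C [nB nC BC]]].
have [x' [x'D Bx']] := dense_rational_points xa nB.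
have [y' [y'D Cy']] := dense_rational_points ya nC.
have := BC x' y' Bx' Cy'; rewrite /= ltNge => /negP; apply.
by apply: ltW; rewrite lt_base; apply: hb; exists (x', y').
Qed.

Definition preserves (f : L2 -> L2) a := forall z, box a z -> box a (f z).

Lemma box_le a b z : (a <= b)%O -> box a z -> box b z.
Proof. by move=> ab [h1 h2]; split; apply: lt_le_trans ab. Qed.

(** The box of a supremum is the increasing union of the boxes of the terms. *)
Lemma preserves_lub (f : L2 -> L2) (u : nat -> W) s :
  (forall n, (u n < s)%O) -> (forall n, (u n < u n.+1)%O) ->
  (forall b, (b < s)%O -> exists n, (b < u n)%O) ->
  (forall n z, box (u n) z -> box (u n.+1) (f z)) -> preserves f s.
Proof.
move=> us ult su hu z [h1 h2].
have ule m n : (m <= n)%N -> (u m <= u n)%O.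
  by apply: (homo_leq lexx le_trans) => k; exact: ltW.
have [n hn] := su _ h1; have [m hm] := su _ h2.
have bz : box (u (maxn n m)) z.
  split; first exact: lt_le_trans hn (ule _ _ (leq_maxl _ _)).
  exact: lt_le_trans hm (ule _ _ (leq_maxr _ _)).
exact: box_le (ltW (us _)) (hu _ _ bz).
Qed.

(** A closing-off argument: [next c] bounds the images of the box of [c] under both maps, and the
    supremum of the iterates of [next] is preserved by both. *)
Lemma exists_preserves (f g : L2 -> L2) a : continuous f -> continuous g ->
  exists b, [/\ (a < b)%O, preserves f b & preserves g b].
Proof.
move=> cf cg.
have c1 (h : L2 -> L2) : continuous h -> continuous (fun z : L2 => (h z).1 : Lplus R W).
  move=> ch z A nA; suff /ch : nbhs (h z) [set w : L2 | A w.1] by [].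
  by exists (A, setT); [split => //; exact: filterT|move=> y []].
have c2 (h : L2 -> L2) : continuous h -> continuous (fun z : L2 => (h z).2 : Lplus R W).
  move=> ch z A nA; suff /ch : nbhs (h z) [set w : L2 | A w.2] by [].
  by exists (setT, A); [split => //; exact: filterT|move=> y []].
have /choice[next nextP] : forall c, exists b, [/\ (c < b)%O,
    forall z, box c z -> box b (f z) & forall z, box c z -> box b (g z)].
  move=> c; have [b1 h1] := bounded_image c (c1 _ cf).
  have [b2 h2] := bounded_image c (c2 _ cf).
  have [b3 h3] := bounded_image c (c1 _ cg).
  have [b4 h4] := bounded_image c (c2 _ cg).
  pose b := Order.max (Order.max b1 b2) (Order.max b3 (Order.max b4 (succ c))).
  exists b; split.
  - by rewrite !lt_max lt_succ !orbT.
  - by move=> z bz; split; [apply: (lt_le_trans (h1 z bz))|apply: (lt_le_trans (h2 z bz))];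
      rewrite !le_max lexx ?orbT.
  - by move=> z bz; split; [apply: (lt_le_trans (h3 z bz))|apply: (lt_le_trans (h4 z bz))];
      rewrite !le_max lexx ?orbT.
pose u n := iter n next (succ a).
have ult n : (u n < u n.+1)%O by have [] := nextP (u n).
have [s [us su]] := lub_seq hW ult.
exists s; split.
- by apply: lt_trans (us 0%N); exact: lt_succ.
- by apply: (preserves_lub us ult su) => n; have [] := nextP (u n).
- by apply: (preserves_lub us ult su) => n; have [] := nextP (u n).
Qed.

Lemma base_bot_lt a : (bot < a)%O -> (base bot < base a)%O.
Proof. by rewrite lt_base. Qed.

(** The hypothesis on [a] keeps clear of the origin, which is not a point of the long ray. *)
Definition corner a (ha : (bot < a)%O) : Lplus R W := in_Lplus (base_bot_lt ha).

(** Any [p] below the corner lies over an ordinal below [a], and there is room above [p] over that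
    same ordinal. *)
Lemma corner_approx a (ha : (bot < a)%O) (A : set (Lplus R W)) :
  nbhs (corner ha) A -> exists x, ((sval x).1 < a)%O /\ A x.
Proof.
move=> /nbhs_Lplus[p [q [/= pa aq hA]]].
have [p' [pp' ep']] := Lge0_above p.
have p'a : (p'.1 < a)%O by rewrite ep' -lt_base.
exists (in_Lplus pp'); split => //; apply: hA => //=.
by apply: lt_trans aq; rewrite lt_base.
Qed.

(** The corner is in the closure of the box, so its image is in the closure of the box too. *)
Lemma corner_image (f : L2 -> L2) a (ha : (bot < a)%O) : continuous f -> preserves f a ->
  (sval (f (corner ha, corner ha)).1 <= base a)%O /\
  (sval (f (corner ha, corner ha)).2 <= base a)%O.
Proof.
move=> cf pf; split; rewrite leNgt; apply/negP => h.
  have : nbhs (f (corner ha, corner ha)) [set z : L2 | (base a < sval z.1)%O].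
    exists ([set x : Lplus R W | (base a < sval x)%O], setT); last by move=> z [].
    by split; [apply: open_nbhs_nbhs; split => //; exact: open_above|exact: filterT].
  move=> /cf /nbhs_pair[B [C [/corner_approx[x [xa Bx]] /corner_approx[y [ya Cy]] BC]]].
  have [h1 _] := pf (x, y) (conj xa ya).
  have := BC x y Bx Cy; rewrite /= ltNge => /negP; apply.
  by apply: ltW; rewrite lt_base.
have : nbhs (f (corner ha, corner ha)) [set z : L2 | (base a < sval z.2)%O].
  exists (setT, [set x : Lplus R W | (base a < sval x)%O]); last by move=> z [].
  by split; [exact: filterT|apply: open_nbhs_nbhs; split => //; exact: open_above].
move=> /cf /nbhs_pair[B [C [/corner_approx[x [xa Bx]] /corner_approx[y [ya Cy]] BC]]].
have [_ h1] := pf (x, y) (conj xa ya).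
have := BC x y Bx Cy; rewrite /= ltNge => /negP; apply.
by apply: ltW; rewrite lt_base.
Qed.

Lemma Ck_on_1 n m k (U : set 'rV[R]_n) (g : 'rV[R]_n -> 'rV[R]_m) :
  Ck_on k.+1 U g -> Ck_on 1 U g.
Proof.
move=> [cg dg hg]; split => // i.
by case: k hg => [|k] /(_ i) //= [].
Qed.

Lemma C_on_1 r n m (U : set 'rV[R]_n) (g : 'rV[R]_n -> 'rV[R]_m) : r <> Cfin 0%N ->
  C_on r U g -> Ck_on 1 U g.
Proof.
case: r => [[|k]|] //= _; first exact: Ck_on_1.
by move=> /(_ 1%N).
Qed.

Lemma phi_base c P a : normal bot c P -> (a < c)%O -> phi P (base a) = P a.
Proof.
move=> nP ac; have [_ _ _ _ [_ s0 _]] := stretchP (inc_gt0 nP ac).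
by rewrite /phi /= s0 ?addr0.
Qed.

(* Near the corner [(a, a)] a C^1 map is Lipschitz.  It maps the points [(xi, xi)] into
   [0, xi]^2 and the corner itself to a point with a coordinate equal to [a], so the
   distance from [xi] to [a] in the target is at most a multiple of that in the source. *)
Lemma corner_lipschitz r (F F' : W -> W -> R) (f : L2 -> L2) a (ha : (bot < a)%O) :
  r <> Cfin 0%N -> (forall c, normal bot c (F c)) -> (forall c, normal bot c (F' c)) ->
  Cr_map r (prod_atlas (phi_atlas hW F) (phi_atlas hW F))
    (prod_atlas (phi_atlas hW F') (phi_atlas hW F')) f ->
  limit a -> preserves f a -> ~ box a (f (corner ha, corner ha)) ->
  exists K eta, (eta < a)%O /\ forall xi, (eta <= xi)%O -> (xi < a)%O ->
    preserves f xi ->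
    F' (succ a) a - F' (succ a) xi <= K * (F (succ a) a - F (succ a) xi).
Proof.
move=> r0 nF nF' [cf hf] la pa nbox; pose c := succ a.
have ac : (a < c)%O := lt_succ hW a.
pose P := F c; pose Q := F' c.
have nP : normal bot c P := nF c; have nQ : normal bot c Q := nF' c.
pose C1 := prod_chart (phi_chart hW c P) (phi_chart hW c P).
pose C2 := prod_chart (phi_chart hW c Q) (phi_chart hW c Q).
have [g [Cg gE]] : exists g : 'rV[R]_(1 + 1) -> 'rV[R]_(1 + 1),
    C_on r (cmap C1 @` (cdom C1 `&` f @^-1` cdom C2)) g /\
    forall z, cdom C1 z -> cdom C2 (f z) -> g (cmap C1 z) = cmap C2 (f z).
  by apply: hf; do 2!eexists; split; first [by eexists | by []].
have dom p b : (b < c)%O -> (p <= base b)%O -> (p.1 < c)%O.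
  rewrite le_eqVlt => bc /orP[/eqP ->//|]; rewrite lt_base => h; exact: lt_trans bc.
pose z0 := (corner ha, corner ha).
have [z1 z2] := corner_image ha cf pa.
have fz0 : cdom C2 (f z0) by split; apply: dom ac _.
have : nbhs (f z0) (cdom C2).
  exists (cdom (phi_chart hW c Q), cdom (phi_chart hW c Q)) => //=.
  by case: fz0 => h1 h2; split; apply: open_nbhs_nbhs; split => //; exact: open_dom.
move=> /cf /nbhs_pair[A [B [/= nA nB AB]]].
have [p [q [/= pa' aq hp]]] := nbhs_Lplus (filterI nA nB).
have [p' [pp' ep']] := Lge0_above p.
have p'a : (p' < base a)%O by rewrite lt_base ep' -lt_base.
have p'c : (p'.1 < c)%O by apply: dom ac (ltW p'a).
(* Points with both coordinates between [P a - dl] and [P a] lie in the neighbourhood of the corner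
   that [f] sends into the target chart. *)
pose dl := phi P (base a) - phi P p'.
have dl0 : 0 < dl by rewrite subr_gt0; apply: phi_lt nP _ p'a.
have surj s : P a - dl <= s <= P a -> exists x : Lplus R W,
    [/\ (p < sval x)%O, (sval x < q)%O, ((sval x).1 < c)%O & phi P (sval x) = s].
  rewrite /dl -(phi_base nP ac) => /andP[h1' h2].
  have h1 : phi P p' <= s by lra.
  have [w [wc ew]] := phi_surj nP p'c (ac : ((base a).1 < c)%O) h1 h2.
  have pw : (p < w)%O.
    by apply: (lt_le_trans pp'); rewrite leNgt -(phi_lt_mono nP wc p'c) ew -leNgt.
  exists (in_Lplus pw); split => //=; apply: le_lt_trans aq.
  by rewrite leNgt -(phi_lt_mono nP _ wc) // ew -leNgt.
have [|K [e [e0 hK]]] := C1_lipschitz (C_on_1 r0 Cg) dl0 (s0 := P a).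
  move=> s t /surj[x [px xq xc <-]] /surj[y [py yq yc <-]].
  exists (x, y) => //; split => //; apply: AB; first by have [] := hp x px xq.
  by have [] := hp y py yq.
have [_ contP] := nP.
have [eta [_ etaa heta]] := contP a la ha (ltW ac) e e0.
(* The maximum forces [bot < xi], so that the corner at [xi] exists. *)
exists K, (Order.max eta (succ bot)); split.
  by rewrite gt_max etaa; case: la => _; apply.
move=> xi; rewrite ge_max succ_le => /andP[exi hxi] xia pxi.
have xic := lt_trans xia ac.
have Pxi : P a - e <= P xi <= P a.
  have := normal_le nP (bot_le _ _) exi (ltW xic).
  have := normal_le nP (bot_le _ _) (ltW xia) (ltW ac); lra.
have := hK _ Pxi.
have -> : vec (P a) (P a) = cmap C1 z0 by rewrite /= (phi_base nP ac).
have -> : vec (P xi) (P xi) = cmap C1 (corner hxi, corner hxi) by rewrite /= (phi_base nP xic).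
have [w1 w2] := corner_image hxi cf pxi.
have fxi : cdom C2 (f (corner hxi, corner hxi)) by split; apply: dom xic _.
rewrite gE // gE //; set w := f (corner hxi, corner hxi) in w1 w2 fxi *.
(* A coordinate [u] of the image of the corner that is at most [base a] without being over an
   ordinal below [a] equals [base a]. *)
have key (u v : Lge0 R W) : (u <= base a)%O -> ~~ (u.1 < a)%O -> (v <= base xi)%O ->
    forall D, `|phi Q u - phi Q v| <= D -> Q a - Q xi <= D.
  rewrite -lt_base => ua; rewrite -leNgt => au vxi D; apply: le_trans.
  have -> : u = base a by apply/eqP; rewrite eq_le ua.
  apply: (le_trans _ (ler_norm _)); rewrite (phi_base nQ ac) lerD2l lerN2.
  by rewrite -(phi_base nQ xic); apply: (phi_le nQ).
move=> hD.
have [h1|h1] := boolP ((sval (f z0).1).1 < a)%O; last first.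
  apply: (key _ _ z1 h1 w1); have := hD (lshift 1 0).
  by rewrite /= !row_mxEl !mxE.
have [h2|h2] := boolP ((sval (f z0).2).1 < a)%O; first by case: nbox.
apply: (key _ _ z2 h2 w2); have := hD (rshift 1 0).
by rewrite /= !row_mxEr !mxE.
Qed.

End Square.

(** * Comparison of the rates at a preserved limit *)

Section Rates.
Local Open Scope ring_scope.
Context (R : realType) (d : Order.disp_t) (W : orderType d) (hW : is_omega1 W).
Implicit Types (a b c x : W) (P Q S : W -> R).

Local Notation bot := (bot hW).
Local Notation succ := (succ hW).
Local Notation limit := (limit hW).
Local Notation normal := (normal hW).
Local Notation coh := (coh hW).
Local Notation L2 := (Lplus R W * Lplus R W)%type.

Lemma finite_below_limit a (A : set W) : limit a -> finite_set A ->
  (forall x, A x -> (x < a)%O) -> exists b, (b < a)%O /\ forall x, A x -> (x < b)%O.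
Proof.
move=> [ba la] /finite_seqP[s ->] {A}; elim: s => [|x s IH] h.
  by exists bot; split => // x; rewrite /= in_nil.
have [y ys|b [b_a hb]] := IH; first by apply: h; rewrite /= inE [y \in s]ys orbT.
exists (Order.max b (succ x)); split.
  by rewrite gt_max b_a la //; apply: h; rewrite /= inE eqxx.
move=> y; rewrite /= inE lt_max lt_succE => /orP[/eqP ->|/hb ->//].
by rewrite lexx orbT.
Qed.

(** The finitely many exceptions are bounded below the limit, and beyond them [P] and [Q] differ by
    a constant: rates at [a] survive a coherent change. *)
Lemma coh_tail a P Q : limit a -> normal bot a P -> normal bot a Q -> coh bot a P Q ->
  exists b, (b < a)%O /\ forall x, (b <= x)%O -> (x <= a)%O -> P a - P x = Q a - Q x.
Proof.
move=> la nP nQ /(finite_below_limit la)[x /= [] //|b [ba hb]].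
exists b; split => // x bx xa.
have nP' := normal_sub (bot_le hW b) (lexx a) nP.
have nQ' := normal_sub (bot_le hW b) (lexx a) nQ.
have e y : (b <= y)%O -> (y < a)%O -> inc hW P y = inc hW Q y.
  move=> yb ya; apply: contrapT => ne.
  by have := hb y (And3 (bot_le hW y) ya ne); rewrite ltNge yb.
have := inc_eq_const nP' nQ' e bx xa.
by have := inc_eq_const nP' nQ' e (ltW ba) (lexx a); lra.
Qed.

Definition has_rate a (u : nat -> W) P (r : R) := forall n, P a - P (u n) = rate r n.

(** If [xi n] lies between [u k] and [u k.+1], then [rate s k.+1] is at most the distance of [Q]
    from [xi n] to [a], hence at most [|K| * rate r k]. For large [k] and [s < r] this contradicts
    [rate_gap]. *)
Lemma rates_comparable a (u xi : nat -> W) P Q (r s K : R) eta : ladder hW a u ->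
  normal bot a P -> normal bot a Q -> has_rate a u P r -> has_rate a u Q s ->
  (eta < a)%O -> (forall n, (xi n < a)%O) ->
  (forall x, (x < a)%O -> exists n, (x < xi n)%O) ->
  (forall n, (eta <= xi n)%O -> Q a - Q (xi n) <= K * (P a - P (xi n))) ->
  0 < s -> ~ s < r.
Proof.
move=> [u0 ult ua ucof] nP nQ rP rQ etaa xia xicof h s0 sr.
have [M hM] := rate_gap `|K| s0 sr.
have ule m n : (m <= n)%N -> (u m <= u n)%O.
  by apply: (homo_leq lexx le_trans) => k; exact: ltW.
have [n] : exists n, (Order.max eta (u M) < xi n)%O.
  by apply: xicof; rewrite gt_max etaa ua.
rewrite gt_max => /andP[/ltW en Mn].
(* The least index of a term above [xi n] is nonzero because the ladder starts at [bot]. *)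
have [[|k] xk mink] := ex_minnP (ucof _ (xia n)).
  by move: xk; rewrite u0 ltNge bot_le.
have uk : (u k <= xi n)%O.
  by rewrite leNgt; apply/negP => /mink; rewrite ltnn.
have Mk : (M <= k)%N.
  rewrite leqNgt; apply/negP => kM.
  by have := lt_le_trans (lt_trans Mn xk) (ule _ _ kM); rewrite ltxx.
have := hM k Mk; rewrite ltNge => /negP; apply.
have hQ := normal_le nQ (bot_le _ _) (ltW xk) (ltW (ua _)).
have hP := normal_le nP (bot_le _ _) uk (ltW (xia _)).
have hP' := normal_le nP (bot_le _ _) (ltW (xia n)) (lexx _).
have -> : rate s k.+1 = Q a - Q (u k.+1) by rewrite rQ.
have -> : rate r k = P a - P (u k) by rewrite rP.
apply: (@le_trans _ _ (Q a - Q (xi n))); first lra.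
apply: (le_trans (h n en)); apply: (@le_trans _ _ (`|K| * (P a - P (xi n)))).
  by rewrite ler_wpM2r ?subr_ge0 // ler_norm.
by rewrite ler_wpM2l //; lra.
Qed.

Definition rated (u : W -> nat -> W) (rho : W -> R) (F : W -> W -> R) :=
  forall a, [/\ normal bot a (F a), forall b, (b < a)%O -> coh bot b (F b) (F a)
    & limit a -> has_rate a (u a) (F a) (rho a)].

(** A smaller [rho' a] means slower convergence of [F'] at [a], which contradicts the Lipschitz
    bound along the [xi n]. *)
Lemma no_diffeo r (u : W -> nat -> W) (rho rho' : W -> R) (F F' : W -> W -> R)
    (f : L2 -> L2) a (ha : (bot < a)%O) (xi : nat -> W) : r <> Cfin 0%N ->
  rated u rho F -> rated u rho' F' -> limit a -> ladder hW a (u a) ->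
  Cr_map r (prod_atlas (phi_atlas hW F) (phi_atlas hW F))
    (prod_atlas (phi_atlas hW F') (phi_atlas hW F')) f ->
  preserves f a -> ~ box a (f (corner R ha, corner R ha)) ->
  (forall n, (xi n < a)%O) -> (forall x, (x < a)%O -> exists n, (x < xi n)%O) ->
  (forall n, preserves f (xi n)) -> 0 < rho' a -> ~ rho' a < rho a.
Proof.
move=> r0 hF hF' la lad Cf pa nbox xia xicof pxi.
have nF c : normal bot c (F c) by have [] := hF c.
have nF' c : normal bot c (F' c) by have [] := hF' c.
have [K [eta [etaa hK]]] := corner_lipschitz r0 nF nF' Cf la pa nbox.
pose c := succ a; have ac : (a < c)%O := lt_succ hW a.
have ncF := normal_sub (lexx _) (ltW ac) (nF c).
have ncF' := normal_sub (lexx _) (ltW ac) (nF' c).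
(* The chart containing the corner has index [succ a], whereas the rate is prescribed for index [a];
   coherence identifies the tails. *)
have [|b [ba hb]] := coh_tail la (nF a) ncF; first by have [_ + _] := hF c; apply.
have [|b' [ba' hb']] := coh_tail la (nF' a) ncF'; first by have [_ + _] := hF' c; apply.
have [_ _ /(_ la) rF] := hF a; have [_ _ /(_ la) rF'] := hF' a.
apply: (rates_comparable (K := K) (eta := Order.max eta (Order.max b b')) lad (nF a) (nF' a)
  rF rF' _ xia xicof); first by rewrite !gt_max etaa ba.
move=> n; rewrite !ge_max => /and3P[h1 h2 h3].
rewrite hb ?(ltW (xia n)) // hb' ?(ltW (xia n)) //.
by apply: hK.
Qed.

End Rates.

(* For every regularity r >= 1 (including r = oo), there is a family,
   indexed by the subsets of omega_1 (so of cardinality 2^aleph_1), of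
   product C^r structures (L_+, D_S) x (L_+, E_S) on L_+^2 which are
   pairwise not C^r-diffeomorphic. *)
Theorem theorem2p2 (R : realType) (d : Order.disp_t) (W : orderType d)
    (hW : is_omega1 W) (r : regularity) (hr : r <> Cfin 0) :
  exists D E : set W -> set (chart R (Lplus R W) 1),
    (forall S : set W, atlas r (D S) /\ atlas r (E S)) /\
    (forall S T : set W, S <> T ->
       ~ diffeomorphic r (prod_atlas (D S) (E S)) (prod_atlas (D T) (E T))).
Proof.
have /choice[u lad] : forall a, exists v : nat -> W, limit hW a -> ladder hW a v.
  move=> a; have [/exists_ladder[v hv]|?] := pselect (limit hW a); first by exists v.
  by exists (fun=> a).
(* Numbering the ordinals below each [a] turns a subset of them into a set of natural numbers. *)
have /choice[e einj] : forall a : W, exists f : W -> nat,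
    {in [set y | (y < a)%O] &, injective f}.
  by move=> a; have [_ _ /(_ a)/countable_injP] := hW.
(* A code may vanish; adding 1 keeps the rate parameter positive. *)
pose rho (S : set W) a : R :=
  (1 + code [set n | exists b, [/\ S b, (b < a)%O & e a b = n]])%R.
have rho0 S a : (0 < rho S a)%R by rewrite ltr_wpDr ?code_ge0.
have /choice[F hF] : forall S, exists F : W -> W -> R, rated hW u (rho S) F.
  move=> S; have [||||F hF] := @coherent_family R _ _ hW u (fun a => rate (rho S a)).
  - exact: lad.
  - by move=> a n; exact: rate_gt0.
  - by move=> a n; exact: rate_lt.
  - by move=> a eps; exact: rate_small.
  - by exists F.
(* Both factors carry the same structure. *)
exists (fun S => phi_atlas hW (F S)), (fun S => phi_atlas hW (F S)); split.
  move=> S; suff : atlas r (phi_atlas hW (F S)) by [].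
  by apply: phi_atlasP => [a|a b]; have [] := hF S a => // _ + _; apply.
move=> S T ST [f [g [fK gK Cf Cg]]]; have [cf _] := Cf; have [cg _] := Cg.
have [w hw] : exists w, ~ (S w <-> T w).
  apply: contrapT => nw; apply: ST; apply/seteqP.
  suff h w : S w <-> T w by split => w /h.
  by apply: contrapT => h; apply: nw; exists w.
have /choice[next nextP] := fun a => exists_preserves hW a cf cg.
(* Starting above [w], where [S] and [T] differ, puts [w] below the limit [a]. *)
pose xi n := iter n.+1 next w.
have xilt n : (xi n < xi n.+1)%O by have [] := nextP (xi n).
have wxi : (w < xi 0)%O by have [] := nextP w.
have pxf n : preserves f (xi n) by have [_ + _] := nextP (iter n next w).
have pxg n : preserves g (xi n) by have [_ _ +] := nextP (iter n next w).
have [a [xia xicof]] := lub_seq hW xilt.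
have la := lub_limit hW xia xicof.
have [ha _] := la.
have pf : preserves f a.
  apply: (preserves_lub xia xilt xicof) => n z bz; apply: box_le (ltW (xilt n)) _.
  exact: pxf.
have pg : preserves g a.
  apply: (preserves_lub xia xilt xicof) => n z bz; apply: box_le (ltW (xilt n)) _.
  exact: pxg.
have ncorner : ~ box a (corner R ha, corner R ha) by move=> [] /=; rewrite ltxx.
(* The inverse preserves the box, so a point outside it cannot be sent inside. *)
have nf : ~ box a (f (corner R ha, corner R ha)) by move=> /pg; rewrite fK.
have ng : ~ box a (g (corner R ha, corner R ha)) by move=> /pf; rewrite gK.
(* The map that goes towards the structure with the smaller parameter gives the contradiction. *)
have [h|h|] := ltgtP (rho S a) (rho T a).
- exact: (no_diffeo hr (hF T) (hF S) la (lad a la) Cg pg ng xia xicof pxg (rho0 S a) h).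
- exact: (no_diffeo hr (hF S) (hF T) la (lad a la) Cf pf nf xia xicof pxf (rho0 T a) h).
(* Equal codes mean that [S] and [T] agree below [a], in particular at [w]. *)
move=> /addrI /code_inj eST; apply: hw.
have wa : (w < a)%O := lt_trans wxi (xia 0).
have mem (A B : set W) : [set n | exists b, [/\ A b, (b < a)%O & e a b = n]] =
    [set n | exists b, [/\ B b, (b < a)%O & e a b = n]] -> A w -> B w.
  move=> eAB Aw; have : [set n | exists b, [/\ A b, (b < a)%O & e a b = n]] (e a w).
    by exists w.
  by rewrite eAB => -[b [Bb ba /einj <-]] //; rewrite inE.
by split; apply: mem.
Qed.
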